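(* Let $V$ be a compact nonsingular real algebraic variety, $n$ a positive integer, and $f\colon V\to\mathbb{S}^n$ a continuous map, where $\mathbb{S}^n=\{(u_0,\ldots,u_n)\in\mathbb{R}^{n+1} : u_0^2+\cdots+u_n^2=1\}$. Then there exists a stratification $\mathcal{S}$ of $V$ such that, for each nonnegative integer $k$, the map $f$ is homotopic to a piecewise $\mathcal{S}$-regular map $g\colon V\to\mathbb{S}^n$ of class $\mathcal{C}^k$.
   Context: A real algebraic variety is a locally ringed space isomorphic to an algebraic subset of $\mathbb{R}^m$ (for some $m$) endowed with the Zariski topology and the sheaf of real-valued regular functions (functions locally of the form $P/Q$ with $P,Q$ polynomials, $Q$ nowhere zero). Morphisms of real algebraic varieties are called regular maps. Each real algebraic variety also carries the Euclidean topology; all topological notions (compact, continuous, connected component, homotopic, ...) refer to the Euclidean topology unless ''Zariski'' is specified. A nonsingular real algebraic variety is naturally a $\mathcal{C}^\infty$ manifold, and ''class $\mathcal{C}^k$'' refers to this structure. Regular map on a subset: let $V,W$ be real algebraic varieties, $X\subseteq V$ any subset, $Z$ the Zariski closure of $X$ in $V$. A map $f\colon X\to W$ is regular if there exist a Zariski open neighborhood $Z_0\subseteq Z$ of $X$ and a regular map $\tilde f\colon Z_0\to W$ with $\tilde f|_X=f$. A stratification of $V$ is a finite collection of pairwise disjoint Zariski locally closed subvarieties of $V$ (some possibly empty) whose union is $V$. A continuous map $g\colon V\to W$ is piecewise $\mathcal{S}$-regular, for a stratification $\mathcal{S}$ of $V$, if for every $S\in\mathcal{S}$ the restriction of $g$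 to each connected component of $S$ is a regular map. *)

(* Defs.v *)
From HB Require Import structures.
From mathcomp Require Import all_boot all_order all_algebra.
From mathcomp Require Import all_classical all_reals all_analysis.
(* Not imported: the notations of mpoly clash with those of the analysis
   library. *)
From mathcomp Require mpoly.
Set Implicit Arguments.
Unset Strict Implicit.
Unset Printing Implicit Defensive.
Import Order.TTheory GRing.Theory Num.Theory.
Import numFieldNormedType.Exports.
Local Open Scope classical_set_scope.
Local Open Scope ring_scope.

(* Real algebraic varieties are handled through a model: an algebraic subset
   [V] of R^m, with m arbitrary.  A map defined on a subset of R^m is
   represented by a total function on R^m, of which only the values on that
   subset are ever used.  The topology of ['rV[R]_m] is the Euclidean one;
   everything that refers to the Zariski topology says so explicitly. *)

Section Zariski.
Variables (R : realType) (m : nat).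
Implicit Types (p : mpoly.mpoly m R) (x : 'rV[R]_m) (V X Z A O S : set 'rV[R]_m).

Definition peval p x : R := mpoly.meval (fun i => x ord0 i) p.

Definition algebraic_set A : Prop :=
  exists E : set (mpoly.mpoly m R), A = [set x | forall p, E p -> peval p x = 0].

Definition zariski_open O : Prop := algebraic_set (~` O).

Definition zariski_open_in Z X : Prop :=
  exists2 O, zariski_open O & X = Z `&` O.

Definition zariski_locally_closed_in V S : Prop :=
  exists A O, [/\ algebraic_set A, zariski_open O & S = V `&` A `&` O].

Definition zariski_closure_in V X : set 'rV[R]_m :=
  V `&` \bigcap_(A in [set A | algebraic_set A /\ X `<=` A]) A.

(* Jacobian form of nonsingularity at [x]: the codimension is [r], so that the
   local dimension m - r may vary from point to point. *)
Definition nonsingular_at V x : Prop :=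
  exists (r : nat) (P : 'I_r -> mpoly.mpoly m R) (O : set 'rV[R]_m),
    [/\ forall i y, V y -> peval (P i) y = 0,
        zariski_open O /\ O x,
        V `&` O = [set y | forall i, peval (P i) y = 0] `&` O
      & row_free (\matrix_(i < r, j < m) peval (mpoly.mderiv j (P i)) x)].

Definition nonsingular V : Prop := forall x, V x -> nonsingular_at V x.

Definition stratification V (SS : set (set 'rV[R]_m)) : Prop :=
  [/\ finite_set SS,
      trivIset SS id,
      \bigcup_(S in SS) S = V
    & forall S, SS S -> zariski_locally_closed_in V S].

Definition regular_function Z (h : 'rV[R]_m -> R) : Prop :=
  forall x, Z x ->
  exists (O : set 'rV[R]_m) (P Q : mpoly.mpoly m R),
    [/\ zariski_open O, O x
      & forall y, Z y -> O y -> peval Q y != 0 /\ h y = peval P y / peval Q y].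

Definition regular_map Z (l : nat) (W : set 'rV[R]_l)
    (h : 'rV[R]_m -> 'rV[R]_l) : Prop :=
  (forall x, Z x -> W (h x)) /\
  forall i : 'I_l, regular_function Z (fun x => h x ord0 i).

(* Regularity of a map [X -> W], where [X] is an arbitrary subset of the
   variety [V]. *)
Definition regular_on V X (l : nat) (W : set 'rV[R]_l)
    (f : 'rV[R]_m -> 'rV[R]_l) : Prop :=
  exists (Z0 : set 'rV[R]_m) (h : 'rV[R]_m -> 'rV[R]_l),
    [/\ X `<=` Z0,
        zariski_open_in (zariski_closure_in V X) Z0,
        regular_map Z0 W h
      & forall x, X x -> h x = f x].

(* [V] and [W] are algebraic sets. *)
Definition continuous_map V (l : nat) (W : set 'rV[R]_l)
    (f : 'rV[R]_m -> 'rV[R]_l) : Prop :=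
  (forall x, V x -> W (f x)) /\ {within V, continuous f}.

Definition piecewise_regular V (SS : set (set 'rV[R]_m)) (l : nat)
    (W : set 'rV[R]_l) (g : 'rV[R]_m -> 'rV[R]_l) : Prop :=
  continuous_map V W g /\
  forall S, SS S -> forall x, S x ->
    regular_on V (connected_component S x) W g.

Definition homotopic V (l : nat) (W : set 'rV[R]_l)
    (f g : 'rV[R]_m -> 'rV[R]_l) : Prop :=
  exists H : 'rV[R]_m * R -> 'rV[R]_l,
    [/\ {within V `*` `[0, 1]%classic, continuous H},
        forall x t, V x -> `[0, 1]%classic t -> W (H (x, t)),
        forall x, V x -> H (x, 0) = f x
      & forall x, V x -> H (x, 1) = g x].

End Zariski.

Section Ck.
Variable R : realType.

(* Maps of class C^k on an open subset [U] of R^d. *)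
Fixpoint class_C_open (k : nat) (d l : nat) (U : set 'rV[R]_d)
    (f : 'rV[R]_d -> 'rV[R]_l) : Prop :=
  match k with
  | 0 => forall x, U x -> {for x, continuous f}
  | k'.+1 => (forall x, U x -> differentiable f x) /\
             forall v : 'rV[R]_d, class_C_open k' U (fun x => 'D_v f x)
  end.

(* [phi], restricted to the open set [U], is the inverse of a chart of the
   C^infinity submanifold structure of [V]: a C^infinity immersion that is a
   homeomorphism from [U] onto an open subset of [V]. *)
Definition smooth_parametrization (m : nat) (V : set 'rV[R]_m) (d : nat)
    (U : set 'rV[R]_d) (phi : 'rV[R]_d -> 'rV[R]_m) : Prop :=
  [/\ open U,
      forall k, class_C_open k U phi,
      forall t, U t -> injective ('d phi t),
      {in U &, injective phi}
    & forall U', open U' -> U' `<=` U ->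
        exists2 O : set 'rV[R]_m, open O & phi @` U' = V `&` O].

(* [l] is the dimension of the ambient space of the target: a map into a
   submanifold W of R^l is of class C^k if and only if it is so as a map into
   R^l. *)
Definition class_C (k : nat) (m : nat) (V : set 'rV[R]_m) (l : nat)
    (g : 'rV[R]_m -> 'rV[R]_l) : Prop :=
  forall x, V x ->
  exists (d : nat) (U : set 'rV[R]_d) (phi : 'rV[R]_d -> 'rV[R]_m),
    [/\ smooth_parametrization V U phi,
        (phi @` U) x
      & class_C_open k U (g \o phi)].

Definition unit_sphere (n : nat) : set 'rV[R]_n.+1 :=
  [set u : 'rV[R]_n.+1 | \sum_(i < n.+1) u ord0 i ^+ 2 = 1].

End Ck.
Arguments unit_sphere : clear implicits.

(* Main.v *)
Require Import Defs.
From HB Require Import structures.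
From mathcomp Require Import all_boot all_order all_algebra.
From mathcomp Require Import all_classical all_reals all_analysis.
From mathcomp Require mpoly.
From mathcomp Require Import ring lra.
Import Order.TTheory GRing.Theory Num.Theory.
Import numFieldNormedType.Exports.
Import -(notations) mpoly.
Local Open Scope classical_set_scope.
Local Open Scope ring_scope.
Set Implicit Arguments.
Unset Strict Implicit.
Unset Printing Implicit Defensive.

(* Approximate f by a polynomial map P = (P0, P') with |P - f| < 1/4 on V; in
   particular P has no zero on V.  Writing inverse stereographic projection in
   homogeneous form, put

     g = (|P'|^2 - s^2, 2 s P') / (|P'|^2 + s^2),  s = max(0, - 2 P0)^(k + 1),

   and g = (1, 0) where P0 >= 0.  As s is of class C^k and vanishes for P0 >= 0,
   g is of class C^k; it is regular where P0 < 0 and constant where P0 >= 0, so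
   the two strata {P0 <> 0} and {P0 = 0} serve for every k.  Finally g never
   equals - f: as g' is a nonnegative multiple of P', g = - f would make P' small,
   so f would be close to a pole; but near (1, 0) and (-1, 0) the values g and f
   have the same first sign, because s >= 1 when f is close to (-1, 0).  Hence
   the normalized segment from f to g is a homotopy. *)

(** * Functions of class C^k *)

(** The radial normalization P / |P| is homotopic to f as well, but its square root is not rational;
    inverse stereographic projection is rational, hence the detour. The price is that a half space
    has to be crushed to the pole at infinity, which no single rational formula does. The sets P0 >
    0 and P0 < 0 need not be separated by the Zariski topology, yet each connected component of {P0
    <> 0} lies in one of them, so one stratum may carry two formulas. Smoothness across P0 = 0 is
    paid for by the exponent of s alone, which keeps the strata independent of k. At P0 = 0 the
    denominator |P'|^2 + s^2 survives because P has no zero. The factor 2 in s makes s >= 1 as soon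
    as P0 <= -1/2, whatever the exponent.

    On the side of V, charts come from local inverses of polynomial maps. Their velocity is a
    rational function of the point reached, so smoothness of every order follows by bootstrapping
    from the first derivative. *)

Section EpsilonDifferential.
Variables (R : realType) (V W : normedModType R).
Implicit Types (f g : V -> W) (x : V).

Lemma diff_epsilon f x (df : {linear V -> W}) : continuous df ->
  (forall e : R, 0 < e ->
    \forall y \near x, `|f y - f x - df (y - x)| <= e * `|y - x|) ->
  differentiable f x /\ 'd f x = df :> (V -> W).
Proof.
move=> dfc fe.
have fo : f \o shift x = cst (f x) + df +o_ 0 id.
  apply/eqaddoP => e e0.
  have := fe e e0; rewrite (near_shift 0 x) => fx; near=> h.
  rewrite !fctE/= opprD addrA.
  have : `|f (h + x) - f x - df (h + x - x)| <= e * `|h + x - x|.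
    by near: h; move: fx; rewrite /= subr0.
  by rewrite addrK.
have dE := diff_unique dfc fo; split=> //.
by apply/diff_locallyP; rewrite dE.
Unshelve. all: by end_near. Qed.

Lemma differentiable_epsilon f x : differentiable f x ->
  forall e : R, 0 < e ->
    \forall y \near x, `|f y - f x - 'd f x (y - x)| <= e * `|y - x|.
Proof.
move=> /diff_locallyP[_ /eqaddoP fo] e e0.
have : \forall h \near (0 : V), `|f (h + x) - (f x + 'd f x h)| <= e * `|h|.
  exact: fo.
rewrite (near_shift x 0) sub0r => fx; near=> y.
have : `|f (y - x + x) - (f x + 'd f x (y - x))| <= e * `|y - x|.
  by near: y; exact: fx.
by rewrite subrK opprD addrA.
Unshelve. all: by end_near. Qed.

Lemma differentiable_near_eq f g x :
  {near x, f =1 g} -> differentiable f x -> differentiable g x.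
Proof.
move=> fg fd; have fx := nbhs_singleton fg.
suff [] : differentiable g x /\ 'd g x = 'd f x :> (V -> W) by [].
apply: diff_epsilon; first exact: diff_continuous.
move=> e e0; near=> y; rewrite -fx.
have <- : f y = g y by near: y; exact: fg.
near: y; exact: differentiable_epsilon.
Unshelve. all: by end_near. Qed.

End EpsilonDifferential.

Section ScalarCk.
Variables (R : realType) (V : normedModType R).
Implicit Types (U : set V) (f g : V -> R) (k : nat).

(** Scalar counterpart of [class_C_open], on any normed space: values in a field allow products and
    inverses. [class_C_open_coord] goes back to vector-valued maps. *)
Fixpoint Ck k U f : Prop :=
  if k is k'.+1 then
    (forall x, U x -> differentiable f x) /\
    forall v, Ck k' U (fun x => 'D_v f x)
  else forall x, U x -> {for x, continuous f}.

Lemma Ck_eq k U f g : open U -> (forall x, U x -> f x = g x) ->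
  Ck k U f -> Ck k U g.
Proof.
move=> oU; elim: k f g => [|k IH] f g fg /=.
  move=> fc x Ux; rewrite /prop_for /continuous_at -fg//.
  apply: cvg_trans (fc x Ux); apply: near_eq_cvg.
  by near=> y; apply/fg; near: y; exact: open_nbhs_nbhs.
move=> [fd fD]; have nfg x : U x -> {near x, f =1 g}.
  by move=> Ux; near=> y; apply/fg; near: y; exact: open_nbhs_nbhs.
split=> [x Ux|v]; first exact: differentiable_near_eq (nfg x Ux) (fd x Ux).
apply: IH (fD v) => x Ux.
exact: near_eq_derive (nfg x Ux).
Unshelve. all: by end_near. Qed.

Lemma CkW k U f : Ck k.+1 U f -> Ck k U f.
Proof.
elim: k f => [|k IH] f /=; first by move=> [fd _] x Ux; exact/differentiable_continuous/fd.
by move=> [fd fD]; split=> // v; apply: IH; exact: fD.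
Qed.

Lemma Ck0 k U f : Ck k U f -> forall x, U x -> {for x, continuous f}.
Proof. by elim: k => // k IH /CkW/IH. Qed.

Lemma Ck_subset k U U' f : U' `<=` U -> Ck k U f -> Ck k U' f.
Proof.
move=> sU; elim: k f => [|k IH] f /=; first by move=> fc x /sU/fc.
by move=> [fd fD]; split=> [x /sU/fd//|v]; exact: IH.
Qed.

Lemma Ck_cst k U c : Ck k U (fun=> c).
Proof.
elim: k c => [|k IH] c /=; first by move=> x _; exact: cvg_cst.
split=> [x _|v]; first exact: differentiable_cst.
suff -> : 'D_v (cst c) = (fun=> 0) :> (V -> R) by exact: IH.
by rewrite funeqE => x; exact: derive_cst.
Qed.

Lemma CkD k U f g : open U -> Ck k U f -> Ck k U g ->
  Ck k U (fun x => f x + g x).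
Proof.
move=> oU; elim: k f g => [|k IH] f g /=.
  by move=> fc gc x Ux; apply: cvgD; [exact: fc|exact: gc].
move=> [fd fD] [gd gD]; split=> [x Ux|v].
  by apply: differentiableD; [exact: fd|exact: gd].
apply: Ck_eq (IH _ _ (fD v) (gD v)) => // x Ux.
by rewrite deriveD//; apply: diff_derivable; [exact: fd|exact: gd].
Qed.

Lemma CkM k U f g : open U -> Ck k U f -> Ck k U g ->
  Ck k U (fun x => f x * g x).
Proof.
move=> oU; elim: k f g => [|k IH] f g.
  by move=> fc gc x Ux; apply: cvgM; [exact: fc|exact: gc].
move=> fC gC; have [fC' gC'] := (CkW fC, CkW gC).
case: fC gC => [fd fD] [gd gD]; split=> [x Ux|v].
  by apply: differentiableM; [exact: fd|exact: gd].
apply: Ck_eq (CkD oU (IH _ _ fC' (gD v)) (IH _ _ gC' (fD v))) => // x Ux.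
by rewrite deriveM//; apply: diff_derivable; [exact: fd|exact: gd].
Qed.

(** The derivative - (1/f) (1/f) Df involves 1/f only to order k, where the induction hypothesis
    applies. *)
Lemma CkV k U f : open U -> (forall x, U x -> f x != 0) -> Ck k U f ->
  Ck k U (fun x => (f x)^-1).
Proof.
move=> oU f0; elim: k => [|k IH] fC.
  by move=> x Ux; apply: cvgV; [exact: f0|exact: fC].
have {}IH := IH (CkW fC); case: fC => [fd fD]; split=> [x Ux|v].
  by apply: differentiableV; [exact: fd|exact: f0].
apply: Ck_eq (CkM oU (CkM oU (Ck_cst k U (-1)) (CkM oU IH IH)) (fD v)) => // x Ux.
rewrite deriveV; [|exact: f0|exact/diff_derivable/fd].
by rewrite mulN1r -invfM -expr2.
Qed.

Lemma CkX k U f n : open U -> Ck k U f -> Ck k U (fun x => f x ^+ n).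
Proof.
move=> oU fC; elim: n => [|n IH]; first exact: Ck_cst.
apply: Ck_eq (CkM oU fC IH) => // x _.
by rewrite exprS.
Qed.

Lemma Ck_sum k U (I : Type) (r : seq I) (P : pred I) (F : I -> V -> R) : open U ->
  (forall i, P i -> Ck k U (F i)) -> Ck k U (fun x => \sum_(i <- r | P i) F i x).
Proof.
move=> oU FC; elim: r => [|i r IH].
  by apply: Ck_eq (Ck_cst k U 0) => // x _; rewrite big_nil.
have [Pi|nPi] := boolP (P i).
  by apply: Ck_eq (CkD oU (FC _ Pi) IH) => // x _; rewrite big_cons Pi.
by apply: Ck_eq IH => // x _; rewrite big_cons (negbTE nPi).
Qed.

Lemma Ck_prod k U (I : Type) (r : seq I) (P : pred I) (F : I -> V -> R) : open U ->
  (forall i, P i -> Ck k U (F i)) -> Ck k U (fun x => \prod_(i <- r | P i) F i x).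
Proof.
move=> oU FC; elim: r => [|i r IH].
  by apply: Ck_eq (Ck_cst k U 1) => // x _; rewrite big_nil.
have [Pi|nPi] := boolP (P i).
  by apply: Ck_eq (CkM oU (FC _ Pi) IH) => // x _; rewrite big_cons Pi.
by apply: Ck_eq IH => // x _; rewrite big_cons (negbTE nPi).
Qed.

End ScalarCk.

(** * Polynomial functions and their differentials *)

Section Polynomials.
Variables (R : realType) (m : nat).
Implicit Types (p q : mpoly m R) (x y z v : 'rV[R]_m).

(** Induction along ring operations instead of monomials, because analytic estimates combine along
    sums and products. *)
Lemma mpoly_ring_ind (Q : mpoly m R -> Prop) :
  (forall c, Q (mpolyC m c)) -> (forall i, Q (mpolyX R (mnm1 i))) ->
  (forall p q, Q p -> Q q -> Q (p + q)) ->
  (forall p q, Q p -> Q q -> Q (p * q)) -> forall p, Q p.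
Proof.
move=> QC QX QD QM; elim/mpolyind => [|c e p _ _ Qp]; first by rewrite -mpolyC0.
apply: QD => //; rewrite -mul_mpolyC; apply: (QM) => //; rewrite mpolyXE_id.
apply: (big_ind Q) => [||i _]; [by rewrite -mpolyC1|exact: QM|].
by elim: (e i) => [|n IH]; [rewrite expr0 -mpolyC1|rewrite exprS; exact: QM].
Qed.

Lemma pevalC c x : peval (mpolyC m c) x = c. Proof. exact: mevalC. Qed.

Lemma pevalXU i x : peval (mpolyX R (mnm1 i)) x = x ord0 i.
Proof. exact: mevalXU. Qed.

Lemma pevalD p q x : peval (p + q) x = peval p x + peval q x.
Proof. exact: mevalD. Qed.

Lemma pevalB p q x : peval (p - q) x = peval p x - peval q x.
Proof. exact: mevalB. Qed.

Lemma pevalM p q x : peval (p * q) x = peval p x * peval q x.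
Proof. exact: mevalM. Qed.

Lemma pevalZ c p x : peval (c *: p) x = c * peval p x.
Proof. exact: mevalZ. Qed.

Lemma peval_exp p n x : peval (p ^+ n) x = peval p x ^+ n.
Proof. exact: rmorphXn. Qed.

Lemma peval_sum (I : Type) (r : seq I) (P : pred I) (F : I -> mpoly m R) x :
  peval (\sum_(i <- r | P i) F i) x = \sum_(i <- r | P i) peval (F i) x.
Proof. exact: raddf_sum. Qed.

Definition peval_diff p x v : R := \sum_j v ord0 j * peval (mderiv j p) x.

Lemma peval_diff_is_linear p x : linear (peval_diff p x).
Proof.
move=> a u v; rewrite /peval_diff /= /GRing.scale/= mulr_sumr -big_split/=.
by apply: eq_bigr => j _; rewrite !mxE mulrDl mulrA.
Qed.

HB.instance Definition _ p x :=
  GRing.isLinear.Build R 'rV[R]_m R _ (peval_diff p x) (peval_diff_is_linear p x).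

Lemma coord_le_norm v j : `|v ord0 j| <= `|v|.
Proof. by rewrite [leRHS]/Num.Def.normr/= mx_normrE; exact: (le_bigmax _ _ (ord0, j)). Qed.

Lemma peval_diff_le p x v :
  `|peval_diff p x v| <= (\sum_j `|peval (mderiv j p) x|) * `|v|.
Proof.
rewrite (le_trans (ler_norm_sum _ _ _))// mulr_suml ler_sum// => j _.
by rewrite normrM mulrC ler_wpM2l// coord_le_norm.
Qed.

Lemma peval_diff_continuous p x : continuous (peval_diff p x).
Proof.
apply: bounded_linear_continuous; apply/linear_boundedP.
exists (\sum_j `|peval (mderiv j p) x|); split; first exact: num_real.
move=> r rC v; apply: le_trans (peval_diff_le p x v) _.
by rewrite ler_wpM2r// ltW.
Qed.

Lemma peval_continuous p : continuous (peval p).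
Proof.
elim/mpoly_ring_ind: p => [c|i|p q pc qc|p q pc qc] x.
- rewrite (_ : peval _ = cst c); first exact: cst_continuous.
  by apply/funext => y; rewrite pevalC.
- rewrite (_ : peval _ = fun y => y ord0 i); first exact: coord_continuous.
  by apply/funext => y; rewrite pevalXU.
- rewrite (_ : peval _ = peval p \+ peval q); first exact: continuousD (pc x) (qc x).
  by apply/funext => y; rewrite pevalD.
- rewrite (_ : peval _ = peval p \* peval q); first exact: continuousM (pc x) (qc x).
  by apply/funext => y; rewrite pevalM.
Qed.

(** Strict differentiability: both points move while the differential stays at [x]. Fixing [z = x]
    gives the differential; the two-point form gives the contraction behind [pmap_local_inverse]. *)
Lemma peval_strict_diff p x (e : R) : 0 < e ->
  exists2 A, nbhs x A & forall y z, A y -> A z ->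
    `|peval p y - peval p z - peval_diff p x (y - z)| <= e * `|y - z|.
Proof.
elim/mpoly_ring_ind: p e => [c|i|p q pd qd|p q pd qd] e e0.
- exists setT => [|y z _ _]; first exact: filterT.
  rewrite !pevalC subrr sub0r normrN /peval_diff big1 ?normr0 ?mulr_ge0// ?ltW//.
  by move=> j _; rewrite mderivC /peval meval0 mulr0.
- exists setT => [|y z _ _]; first exact: filterT.
  rewrite /peval_diff (bigD1 i)//= big1 ?addr0 => [|j ji].
    rewrite !pevalXU mderivX mnm1E eqxx scale1r -[(y - z) _ _]/((y - z) ord0 i).
    rewrite /peval mevalX big1 => [|l _]; last by rewrite mnmBE subnn expr0.
    rewrite mulr1 !mxE subrr normr0.
    by rewrite mulr_ge0// ltW.
  by rewrite mderivX mnm1E eq_sym (negbTE ji) scale0r /peval meval0 mulr0.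
- have e20 : 0 < e / 2 by rewrite divr_gt0.
  have [[A nA pE] [B nB qE]] := (pd _ e20, qd _ e20).
  exists (A `&` B) => [|y z [Ay By] [Az Bz]]; first exact: filterI.
  have {}pE := pE y z Ay Az; have {}qE := qE y z By Bz.
  rewrite (splitr e) mulrDl (le_trans _ (lerD pE qE))//.
  apply: le_trans _ (ler_normD _ _); rewrite le_eqVlt; apply/orP; left; apply/eqP.
  congr `|_|; rewrite !pevalD.
  suff -> : peval_diff (p + q) x (y - z) = peval_diff p x (y - z) + peval_diff q x (y - z).
    by ring.
  rewrite /peval_diff -big_split/=; apply: eq_bigr => j _.
  by rewrite mderivD pevalD mulrDr.
- pose C p : R := \sum_j `|peval (mderiv j p) x|.
  have C0 r : 0 <= C r by apply: sumr_ge0.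
  (* [K] adds up the cofactors of [d] in the bounds of the four error terms of the product; the
     [+ 1] absorb the variation of [p] and [q], at most [d <= 1]. *)
  pose K : R := (`|peval q x| + 1) + C p + (`|peval p x| + 1) + C q.
  have K0 : 0 < K.
    have := C0 p; have := C0 q; have := normr_ge0 (peval p x).
    by have := normr_ge0 (peval q x); rewrite /K; lra.
  pose d := Num.min 1 (e / K).
  have d0 : 0 < d by rewrite lt_min ltr01 divr_gt0.
  have d1 : d <= 1 by rewrite ge_min lexx.
  have dK : d * K <= e by rewrite -ler_pdivlMr// ge_min lexx orbT.
  have [[A nA pE] [B nB qE]] := (pd _ d0, qd _ d0).
  have np : \forall y \near x, `|peval p y - peval p x| <= d.
    exact: cvgr_distC_le (@peval_continuous p x) _ d0.
  have nq : \forall y \near x, `|peval q y - peval q x| <= d.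
    exact: cvgr_distC_le (@peval_continuous q x) _ d0.
  exists (A `&` B `&` ([set y | `|peval p y - peval p x| <= d] `&`
                     [set y | `|peval q y - peval q x| <= d])).
    by apply: filterI; exact: filterI.
  move=> y z [[Ay By] [_ qy]] [[Az Bz] [pz _]].
  have {}pE := pE y z Ay Az; have {}qE := qE y z By Bz.
  have pL := peval_diff_le p x (y - z); have qL := peval_diff_le q x (y - z).
  rewrite -/(C p) in pL; rewrite -/(C q) in qL.
  set h := `|y - z| in pE qE pL qL *; have h0 : 0 <= h by exact: normr_ge0.
  have LE : peval_diff (p * q) x (y - z) =
      peval_diff p x (y - z) * peval q x + peval p x * peval_diff q x (y - z).
    rewrite /peval_diff mulr_suml mulr_sumr -big_split/=; apply: eq_bigr => j _.
    by rewrite mderivM pevalD !pevalM; ring.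
  rewrite LE !pevalM.
  set a := peval p y - _ - _ in pE; set b := peval q y - _ - _ in qE.
  set a' := peval_diff p _ _ in a pE pL LE *; set b' := peval_diff q _ _ in b qE qL LE *.
  (* Each of the four terms has one factor of order [d]: a linearization error or a variation from
     [x]. *)
  have -> : peval p y * peval q y - peval p z * peval q z - (a' * peval q x + peval p x * b') =
    a * peval q y + a' * (peval q y - peval q x) + peval p z * b + (peval p z - peval p x) * b'.
    by rewrite /a /b; ring.
  have qy1 : `|peval q y| <= `|peval q x| + 1.
    rewrite -[peval q y](subrK (peval q x)) addrC (le_trans (ler_normD _ _))//.
    by rewrite lerD2l (le_trans qy).
  have pz1 : `|peval p z| <= `|peval p x| + 1.
    rewrite -[peval p z](subrK (peval p x)) addrC (le_trans (ler_normD _ _))//.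
    by rewrite lerD2l (le_trans pz).
  apply: le_trans (ler_wpM2r h0 dK).
  have bnd (u w U W : R) : `|u| <= U -> `|w| <= W -> `|u * w| <= U * W.
    by move=> uU wW; rewrite normrM ler_pM.
  have -> : d * K * h = d * h * (`|peval q x| + 1) + C p * h * d +
      (`|peval p x| + 1) * (d * h) + d * (C q * h) by rewrite /K; ring.
  rewrite (le_trans (ler_normD _ _))// lerD ?bnd//.
  rewrite (le_trans (ler_normD _ _))// lerD ?bnd//.
  by rewrite (le_trans (ler_normD _ _))// lerD ?bnd.
Qed.

Lemma peval_diffE p x :
  differentiable (peval p) x /\ 'd (peval p) x = peval_diff p x :> ('rV[R]_m -> R).
Proof.
apply: diff_epsilon => [|e e0]; first exact: peval_diff_continuous.
have [A nA AP] := peval_strict_diff p x e0; near=> y.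
by apply: AP; [near: y|exact: nbhs_singleton].
Unshelve. all: by end_near. Qed.

Lemma derive_peval p x v : 'D_v (peval p) x = peval_diff p x v.
Proof. by have [pd <-] := peval_diffE p x; rewrite deriveE. Qed.

Lemma Ck_peval k U p : open U -> Ck k U (peval p).
Proof.
move=> oU; elim: k p => [|k IH] p; first by move=> x _; exact: peval_continuous.
split=> [x _|v]; first by have [] := peval_diffE p x.
apply: Ck_eq (_ : Ck k U (peval (\sum_j v ord0 j *: mderiv j p))) => // x _.
rewrite derive_peval peval_sum; apply: eq_bigr => j _.
by rewrite pevalZ.
Qed.

End Polynomials.

(** * Row vectors and matrices, coordinate by coordinate *)

Section RowVectors.
Variable R : realType.

Lemma row_norm_le n (v : 'rV[R]_n) (c : R) : 0 <= c ->
  (forall i, `|v ord0 i| <= c) -> `|v| <= c.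
Proof.
move=> c0 vc; rewrite [leLHS]/Num.Def.normr/= mx_normrE.
by apply: bigmax_le => // -[i j] _ /=; rewrite (ord1 i).
Qed.

Lemma mulmx_row_le n p (M : 'M[R]_(n, p)) (v : 'rV[R]_n) :
  `|v *m M| <= (\sum_i \sum_j `|M i j|) * `|v|.
Proof.
have s0 : 0 <= \sum_i \sum_j `|M i j| by do 2 (apply: sumr_ge0 => ? _).
apply: row_norm_le => [|j]; first exact: mulr_ge0.
rewrite mxE (le_trans (ler_norm_sum _ _ _))// mulr_suml ler_sum// => i _.
rewrite normrM mulrC ler_pM// ?coord_le_norm//.
by rewrite (bigD1 j)//= lerDl sumr_ge0.
Qed.

Lemma mulmxr_continuous n p (M : 'M[R]_(n, p)) :
  continuous (mulmxr M : 'rV[R]_n -> 'rV[R]_p).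
Proof.
apply: bounded_linear_continuous; apply/linear_boundedP.
exists (\sum_i \sum_j `|M i j|); split; first exact: num_real.
move=> r rC v; apply: le_trans (mulmx_row_le M v) _.
by rewrite ler_wpM2r// ltW.
Qed.

Lemma open_norm_lt (T : topologicalType) (W : normedModType R) (g : T -> W) (c : R) :
  0 < c -> continuous g -> open [set y | `|g y| < c].
Proof.
move=> c0 gc; rewrite (_ : [set y | _] = g @^-1` ball 0 c).
  by apply: open_comp; [move=> y _; exact: gc|exact: ball_open].
by apply/seteqP; split => y; rewrite -ball_normE /ball_/= sub0r normrN.
Qed.

Lemma row_sum_coord (V : Type) n (f : V -> 'rV[R]_n) :
  f = (fun x => \sum_i f x ord0 i *: delta_mx ord0 i).
Proof. by apply/funext => x; exact: row_sum_delta. Qed.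

Lemma continuous_row (T : topologicalType) n (f : T -> 'rV[R]_n) x :
  (forall i, {for x, continuous (fun y => f y ord0 i)}) -> {for x, continuous f}.
Proof.
move=> fc; apply/cvgrPdist_le => e e0; near=> y.
apply: row_norm_le => [|i]; first exact: ltW.
rewrite !mxE; move: i; near: y; apply: filter_forall => i.
by have /cvgrPdist_le := fc i; exact.
Unshelve. all: by end_near. Qed.

Lemma differentiable_row (V : normedModType R) n (f : V -> 'rV[R]_n) x :
  (forall i, differentiable (fun y => f y ord0 i) x) -> differentiable f x.
Proof.
move=> fd; rewrite (row_sum_coord f).
rewrite (_ : (fun _ => _) =
  \sum_i (fun y => f y ord0 i *: delta_mx ord0 i)); last first.
  by apply/funext => y; rewrite fct_sumE.
apply: differentiable_sum => i; exact: differentiableZl.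
Qed.

Lemma derive_coord (V : normedModType R) n (f : V -> 'rV[R]_n) x v i :
  differentiable f x -> ('D_v f x) ord0 i = 'D_v (fun y => f y ord0 i) x.
Proof. by move=> fd; rewrite derive_mx ?mxE//; exact: diff_derivable. Qed.

Lemma class_C_open_coord k d l (U : set 'rV[R]_d) (f : 'rV[R]_d -> 'rV[R]_l) :
  open U -> (forall i, Ck k U (fun x => f x ord0 i)) -> class_C_open k U f.
Proof.
move=> oU; elim: k f => [|k IH] f fC.
  by move=> x Ux; apply: continuous_row => i; exact: fC.
have fd x : U x -> differentiable f x.
  by move=> Ux; apply: differentiable_row => i; have [fd _] := fC i; exact: fd.
split=> // v; apply: IH => i; have [_ /(_ v)] := fC i.
by apply: Ck_eq => // x Ux; rewrite derive_coord//; exact: fd.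
Qed.

Lemma Ck_det (V : normedModType R) k (U : set V) n (A : V -> 'M[R]_n) : open U ->
  (forall i j, Ck k U (fun x => A x i j)) -> Ck k U (fun x => \det (A x)).
Proof.
move=> oU AC; apply: Ck_sum => // s _; apply: CkM => //; first exact: Ck_cst.
exact: Ck_prod.
Qed.

Lemma Ck_invmx (V : normedModType R) k (U : set V) n (A : V -> 'M[R]_n) i j :
  open U -> (forall x, U x -> A x \in unitmx) ->
  (forall i j, Ck k U (fun x => A x i j)) -> Ck k U (fun x => invmx (A x) i j).
Proof.
move=> oU Au AC.
apply: (Ck_eq (f := fun x => (\det (A x))^-1 *
    ((-1) ^+ (j + i) * \det (row' j (col' i (A x)))))) => // [x Ux|].
  by rewrite /invmx Au// !mxE.
apply: CkM => //.
  by apply: CkV => //; [move=> x /Au; rewrite unitmxE unitfE|exact: Ck_det].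
apply: CkM => //; first exact: Ck_cst.
apply: Ck_det => // a b.
by apply: Ck_eq (AC (lift j a) (lift i b)) => // x _; rewrite !mxE.
Qed.

(* The velocity of [phi] being [X v] read along [phi], every derivative of
   [h \o phi] is again a function of the same form. *)
Lemma Ck_comp_flow k (V : normedModType R) n (U : set V) (O : set 'rV[R]_n)
    (phi : V -> 'rV[R]_n) (X : V -> 'I_n -> 'rV[R]_n -> R) h :
  open U -> open O -> (forall t, U t -> O (phi t)) ->
  (forall t, U t -> differentiable phi t) ->
  (forall t v j, U t -> ('D_v phi t) ord0 j = X v j (phi t)) ->
  (forall k v j, Ck k O (X v j)) -> Ck k O h -> Ck k U (h \o phi).
Proof.
move=> oU oO UO phid phiX XC; elim: k h => [|k IH] h hC.
  move=> t Ut; apply: continuous_comp; last by apply: hC; exact: UO.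
  exact/differentiable_continuous/phid.
have [hd hD] := hC; split=> [t Ut|v].
  by apply: differentiable_comp; [exact: phid|exact/hd/UO].
apply: Ck_eq (IH (fun y => \sum_j X v j y * 'D_(delta_mx ord0 j) h y) _) => //.
  move=> t Ut; have [pd hd'] := (phid t Ut, hd _ (UO t Ut)).
  rewrite deriveE; last exact: differentiable_comp.
  rewrite diff_comp//= [in RHS](row_sum_delta ('d phi t v)) linear_sum/=.
  apply: eq_bigr => j _.
  by rewrite linearZ/= deriveE// -phiX// deriveE.
apply: Ck_sum => // j _.
exact: (CkM oO (XC k v j) (hD (delta_mx ord0 j))).
Qed.

End RowVectors.

(** * Parametrization of nonsingular algebraic sets *)

Section PolynomialMaps.
Variables (R : realType) (m n : nat).
Implicit Types (F : 'I_n -> mpoly m R) (x y z v : 'rV[R]_m).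

Definition pmap F y : 'rV[R]_n := \row_i peval (F i) y.

Definition pjac F y : 'M[R]_(m, n) := \matrix_(j, i) peval (mderiv j (F i)) y.

Lemma pjacE F y v i : (v *m pjac F y) ord0 i = peval_diff (F i) y v.
Proof. by rewrite mxE; apply: eq_bigr => j _; rewrite mxE. Qed.

Lemma pmap_strict_diff F x (e : R) : 0 < e ->
  exists2 A, nbhs x A & forall y z, A y -> A z ->
    `|pmap F y - pmap F z - (y - z) *m pjac F x| <= e * `|y - z|.
Proof.
move=> e0;
have /choice[B PB] : forall i, exists A, nbhs x A /\ forall y z, A y -> A z ->
    `|peval (F i) y - peval (F i) z - peval_diff (F i) x (y - z)| <= e * `|y - z|.
  by move=> i; have [B nB BP] := peval_strict_diff (F i) x e0; exists B.
have nB : \forall y \near x, forall i, B i y.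
  exact: (@filter_forall _ _ B (nbhs x) _ (fun i => (PB i).1)).
exists [set y | forall i, B i y] => // y z By Bz.
apply: row_norm_le => [|i]; first by rewrite mulr_ge0// ltW.
have [_ /(_ y z (By i) (Bz i))] := PB i.
by rewrite -pjacE; move: (_ *m _) => w; rewrite !mxE.
Qed.

Lemma pmap_epsilon F x (e : R) : 0 < e ->
  \forall y \near x, `|pmap F y - pmap F x - (y - x) *m pjac F x| <= e * `|y - x|.
Proof.
move=> e0; have [A nA AP] := pmap_strict_diff F x e0; near=> y.
by apply: AP; [near: y|exact: nbhs_singleton].
Unshelve. all: by end_near. Qed.

Lemma pmap_continuous F : continuous (pmap F).
Proof.
move=> x; apply: continuous_row => i.
rewrite (_ : (fun _ => _) = peval (F i)); first exact: peval_continuous.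
by apply/funext => y; rewrite mxE.
Qed.

End PolynomialMaps.

HB.instance Definition _ (R : realType) (m n : nat) := Complete.on 'M[R]_(m, n).

(** * Local inversion of polynomial maps *)

Section LocalInverse.
Variables (R : realType) (m : nat) (F : 'I_m -> mpoly m R) (x : 'rV[R]_m).
Hypotheses (Fx : pmap F x = 0) (Jx : pjac F x = 1%:M).

Let half_gt0 : 0 < 2^-1 :> R. Proof. by rewrite invr_gt0. Qed.

(** As the Jacobian at [x] is 1, strict differentiability makes y - F y a contraction of ratio 1/2
    near [x]. Hence F is injective there with a 2-Lipschitz inverse, and F y = w is solved by the
    Banach fixed point theorem. *)
Lemma pmap_local_inverse (N : set 'rV[R]_m) : nbhs x N ->
  exists (rho : R) (psi : 'rV[R]_m -> 'rV[R]_m),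
  [/\ 0 < rho,
      forall y, `|y - x| < rho -> N y,
      forall y z, `|y - x| < rho -> `|z - x| < rho ->
        `|y - z| <= 2 * `|pmap F y - pmap F z|
    & forall w, `|w| < rho / 2 -> `|psi w - x| < rho /\ pmap F (psi w) = w].
Proof.
move=> nN; have [A nA AP] := pmap_strict_diff F x half_gt0.
have /nbhs_ballP[rho /= rho0 NA] : nbhs x (N `&` A) by exact: filterI.
have {}NA y : `|y - x| < rho -> N y /\ A y.
  by move=> yx; apply: NA; rewrite -ball_normE /ball_/= distrC.
have lip y z : `|y - x| < rho -> `|z - x| < rho ->
    `|pmap F y - pmap F z - (y - z)| <= 2^-1 * `|y - z|.
  move=> /NA[_ Ay] /NA[_ Az]; have := AP _ _ Ay Az.
  by rewrite Jx mulmx1.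
have inv w : `|w| < rho / 2 -> exists y, `|y - x| < rho /\ pmap F y = w.
  move=> wrho; pose U : set 'rV[R]_m := closed_ball_ Num.norm x (2 * `|w|).
  have Urho y : U y -> `|y - x| < rho.
    rewrite /U/closed_ball_/= distrC => /le_lt_trans; apply.
    by rewrite mulrC -ltr_pdivlMr.
  pose G y := y - (pmap F y - w).
  have Glip y z : U y -> U z -> `|G y - G z| <= 2^-1 * `|y - z|.
    move=> /Urho yx /Urho zx; rewrite (le_trans _ (lip _ _ yx zx))//.
    rewrite -normrN /G le_eqVlt; apply/orP; left; apply/eqP; congr `|_|.
    by rewrite !opprB !addrA; apply/rowP => i; rewrite !mxE; ring.
  have Ux : U x by rewrite /U/closed_ball_/= subrr normr0 mulr_ge0.
  have GU : {homo G : y / U y >-> U y}.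
    move=> y Uy; rewrite /U/closed_ball_/= distrC.
    have -> : G y - x = (G y - G x) + w.
      by rewrite /G Fx; apply/rowP => i; rewrite !mxE; ring.
    rewrite (le_trans (ler_normD _ _))// (le_trans (lerD (Glip _ _ Uy Ux) (lexx _)))//.
    move: Uy; rewrite /U/closed_ball_/= distrC; lra.
  have [|||y Uy yG] := @banach_fixed_point R 'rV[R]_m U (mkfun_fun GU).
  - exists (2^-1)%:nng; split => /=; first lra.
    move=> [y z] [/= Uy Uz]; exact: Glip.
  - exact: closed_closed_ball_.
  - by exists x.
  exists y; split; first exact: Urho.
  have yGy : y = G y := yG.
  by have /eqP := subrr y; rewrite {2}yGy /G subKr subr_eq0 => /eqP.
have /choice[psi psiP] : forall w, exists y, `|w| < rho / 2 ->
    `|y - x| < rho /\ pmap F y = w.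
  move=> w; have [/inv[y Py]|] := pselect (`|w| < rho / 2); first by exists y.
  by exists 0.
exists rho, psi; split=> // [y /NA[]//|y z yx zx].
have := lip y z yx zx.
have := lerB_normD (y - z) (pmap F y - pmap F z - (y - z)).
rewrite subrKC. lra.
Qed.

End LocalInverse.

Section InverseParametrization.
Variables (R : realType) (m d : nat) (F : 'I_m -> mpoly m R) (x : 'rV[R]_m).
Variables (rho : R) (psi : 'rV[R]_m -> 'rV[R]_m) (E : 'M[R]_(d, m)).
Hypothesis rho_gt0 : 0 < rho.
Hypothesis lip : forall y z, `|y - x| < rho -> `|z - x| < rho ->
  `|y - z| <= 2 * `|pmap F y - pmap F z|.
Hypothesis psiK : forall w, `|w| < rho / 2 ->
  `|psi w - x| < rho /\ pmap F (psi w) = w.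
Hypothesis Junit : forall y, `|y - x| < rho -> pjac F y \in unitmx.

Let U : set 'rV[R]_d := [set t | `|t *m E| < rho / 2].
Let phi (t : 'rV[R]_d) := psi (t *m E).

Let phi_near t : U t -> `|phi t - x| < rho.
Proof. by move=> /psiK[]. Qed.

Let phiK t : U t -> pmap F (phi t) = t *m E.
Proof. by move=> /psiK[]. Qed.

Lemma open_ball_image (M : 'M[R]_(d, m)) : open [set t : 'rV[R]_d | `|t *m M| < rho / 2].
Proof. by apply: open_norm_lt; [rewrite divr_gt0|exact: mulmxr_continuous]. Qed.

Let KE : R := \sum_i \sum_j `|E i j|.
Let KE_ge0 : 0 <= KE. Proof. by do 2 (apply: sumr_ge0 => ? _). Qed.

Lemma inverse_lipschitz s t : U s -> U t -> `|phi s - phi t| <= 2 * KE * `|s - t|.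
Proof.
move=> Us Ut; apply: le_trans (lip (phi_near Us) (phi_near Ut)) _.
by rewrite -mulrA ler_wpM2l// !phiK// -mulmxBl mulmx_row_le.
Qed.

Lemma inverse_continuous t : U t -> {for t, continuous phi}.
Proof.
move=> Ut; apply/(@cvgrPdist_le _ _ _ (nbhs t)) => e e0; near=> s.
have Us : U s by near: s; apply: open_nbhs_nbhs; split=> //; exact: open_ball_image.
rewrite (le_trans (inverse_lipschitz Ut Us))//.
have st : `|t - s| <= e / (2 * KE + 1).
  near: s; apply: (@cvgr_dist_le _ _ _ (nbhs t) _ id); first exact: cvg_id.
  by rewrite divr_gt0// ltr_wpDl// mulr_ge0.
apply: le_trans (ler_wpM2l _ st) _; first exact: mulr_ge0.
rewrite mulrCA ger_pMr// ler_pdivrMr ?ltr_wpDl ?mulr_ge0//.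
by rewrite mul1r lerDl.
Unshelve. all: by end_near. Qed.

(** Linearizing F (phi s) = s E at [phi t] gives (phi s - phi t) J = (s - t) E up to an error small
    against |phi s - phi t|; the Lipschitz bound makes it small against |s - t|, and J is then
    inverted. *)
Lemma inverse_diff t : U t ->
  differentiable phi t /\
  'd phi t = mulmxr (E *m invmx (pjac F (phi t))) :> ('rV[R]_d -> 'rV[R]_m).
Proof.
move=> Ut; set J := pjac F (phi t); have Ju : J \in unitmx by exact/Junit/phi_near.
apply: diff_epsilon => [|e e0]; first exact: mulmxr_continuous.
pose KJ : R := \sum_i \sum_j `|invmx J i j|.
have KJ_ge0 : 0 <= KJ by do 2 (apply: sumr_ge0 => ? _).
(* [KJ * (2 * KE)] is the loss from inverting J and from the Lipschitz bound; adding 1 keeps the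
   divisor positive. *)
pose K := KJ * (2 * KE) + 1.
have K0 : 0 < K by rewrite ltr_wpDl// !mulr_ge0.
have e10 : 0 < e / K by rewrite divr_gt0.
near=> s.
have Us : U s by near: s; apply: open_nbhs_nbhs; split=> //; exact: open_ball_image.
have sE : `|pmap F (phi s) - pmap F (phi t) - (phi s - phi t) *m J| <=
    e / K * `|phi s - phi t|.
  by near: s; exact: (inverse_continuous Ut (pmap_epsilon F (phi t) e10)).
have -> : phi s - phi t - mulmxr (E *m invmx J) (s - t) =
    - (pmap F (phi s) - pmap F (phi t) - (phi s - phi t) *m J) *m invmx J.
  rewrite /= mulmxA !phiK// -mulmxBl; set D := phi s - phi t.
  set w := (s - t) *m E.
  by rewrite mulNmx [in RHS]mulmxBl -[D *m J *m _]mulmxA mulmxV// mulmx1 opprB.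
rewrite (le_trans (mulmx_row_le _ _))// normrN -/KJ.
apply: le_trans (ler_wpM2l KJ_ge0 sE) _.
apply: le_trans (ler_wpM2l _ (ler_wpM2l _ (inverse_lipschitz Us Ut))) _ => //.
  by rewrite ltW.
rewrite [leLHS](_ : _ = e * `|s - t| * (KJ * (2 * KE) / K)); last by ring.
rewrite ler_piMr ?mulr_ge0// ?(ltW e0)// ler_pdivrMr// mul1r.
by rewrite /K lerDl.
Unshelve. all: by end_near. Qed.

(** By [inverse_diff] the velocity of [phi] is v E J(y)^-1 at y = phi t. Its entries are rational in
    y by Cramer's rule, hence of every class, so [Ck_comp_flow] applies. *)
Lemma Ck_comp_inverse k (O : set 'rV[R]_m) h : open O ->
  (forall t, U t -> O (phi t)) -> Ck k O h -> Ck k U (h \o phi).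
Proof.
move=> oO UO hC; have oU : open U by exact: open_ball_image.
pose B := [set y : 'rV[R]_m | `|y - x| < rho].
have oB : open B.
  apply: open_norm_lt => // y.
  by apply: continuousB; [exact: cvg_id|exact: cst_continuous].
apply: (@Ck_comp_flow _ _ _ _ _ (O `&` B) _
    (fun v j y => (v *m E *m invmx (pjac F y)) ord0 j)) => //.
- exact: openI.
- by move=> t Ut; split; [exact: UO|exact: phi_near].
- by move=> t /inverse_diff[].
- move=> t v j Ut; have [pd pE] := inverse_diff Ut.
  by rewrite deriveE// pE /= mulmxA.
- move=> l v j; apply: (Ck_subset (U := B)); first by move=> y [].
  apply: (Ck_eq (f := fun y => \sum_i (v *m E) ord0 i * invmx (pjac F y) i j)) => //.
    by move=> y _; rewrite [in RHS]mxE.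
  apply: Ck_sum => // i _; apply: CkM => //; first exact: Ck_cst.
  apply: Ck_invmx => // a b.
  apply: Ck_eq (Ck_peval l (mderiv a (F b)) oB) => // y _.
  by rewrite mxE.
- by apply: Ck_subset hC => y [].
Qed.

End InverseParametrization.

Section NonsingularParametrization.
Variables (R : realType) (m : nat).
Implicit Types (V N O : set 'rV[R]_m) (x y : 'rV[R]_m).

Lemma algebraic_set_closed (A : set 'rV[R]_m) : algebraic_set A -> closed A.
Proof.
move=> [E ->]; rewrite (_ : [set x | _] = \bigcap_(p in E) (peval p @^-1` [set 0])).
  apply: closed_bigI => p _; apply: preimage_closed; last exact: closed_eq.
  by move=> y _; exact: peval_continuous.
by apply/seteqP; split.
Qed.

Lemma zariski_open_open O : zariski_open O -> open O.
Proof. by move=> /algebraic_set_closed/closed_openC; rewrite setCK. Qed.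

Lemma Ck_coord k (U : set 'rV[R]_m) i : open U -> Ck k U (fun y => y ord0 i).
Proof.
by move=> oU; apply: Ck_eq (Ck_peval k (mpolyX R (mnm1 i)) oU) => // y _; rewrite pevalXU.
Qed.

Lemma peval_mderivXU (a j : 'I_m) y :
  peval (mderiv a (mpolyX R (mnm1 j))) y = (j == a)%:R.
Proof.
rewrite mderivX mnm1E; case: eqP => [->|_]; last by rewrite scale0r /peval meval0.
by rewrite scale1r /peval mevalX big1// => l _; rewrite mnmBE subnn expr0.
Qed.

(* Near [x] the set [V] is the zero set of [P].  If [L] is a left inverse of
   the Jacobian [M] of [P] at [x], the map [F y = P y L + (y - x) (1 - M L)] has
   derivative 1 at [x] and sends [V] into the row space of [1 - M L]: a local
   inverse of [F] restricted to that space parametrizes [V]. *)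
Lemma nonsingular_parametrization V x N :
  nonsingular_at V x -> V x -> nbhs x N ->
  exists (d : nat) (U : set 'rV[R]_d) (phi : 'rV[R]_d -> 'rV[R]_m),
  [/\ smooth_parametrization V U phi,
      (phi @` U) x,
      open U,
      forall t, U t -> N (phi t)
    & forall k (h : 'rV[R]_m -> R) O', open O' -> (forall t, U t -> O' (phi t)) ->
        Ck k O' h -> Ck k U (h \o phi)].
Proof.
move=> [r [P [ O [PV [zO Ox] VO Jfree]]]] Vx nN; move: Jfree.
rewrite (_ : \matrix_(i, j) _ = (pjac P x)^T); last by apply/matrixP => i j; rewrite !mxE.
move=> /row_freeP[L']; set M := pjac P x; pose L := L'^T => ML'.
have LM : L *m M = 1%:M by rewrite -[M]trmxK -trmx_mul ML' trmx1.
(* Projector onto the left kernel of [M], that is, onto the tangent space of [V] at [x]. *)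
pose K : 'M[R]_m := 1%:M - M *m L.
have KM : K *m M = 0 by rewrite mulmxBl mul1mx -mulmxA LM mulmx1 subrr.
pose F i : mpoly m R := \sum_l L l i *: P l +
  \sum_j K j i *: (mpolyX R (mnm1 j) - mpolyC m (x ord0 j)).
have FE y : pmap F y = pmap P y *m L + (y - x) *m K.
  apply/rowP => i; rewrite !mxE pevalD !peval_sum; congr (_ + _).
    by apply: eq_bigr => l _; rewrite pevalZ [pmap _ _ _ _]mxE [LHS]mulrC.
  apply: eq_bigr => j _.
  by rewrite pevalZ pevalB pevalXU pevalC [(y - x) _ _]mxE [(- x) _ _]mxE [LHS]mulrC.
have JE y : pjac F y = pjac P y *m L + K.
  apply/matrixP => a i; rewrite [LHS]mxE [RHS]mxE [(_ *m L) _ _]mxE mderivD pevalD.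
  rewrite !raddf_sum/= !peval_sum; congr (_ + _).
    by apply: eq_bigr => l _; rewrite mderivZ pevalZ [pjac _ _ _ _]mxE [LHS]mulrC.
  rewrite (bigD1 a)//= big1 => [|j ja];
    rewrite mderivZ mderivB mderivC subr0 pevalZ peval_mderivXU.
    by rewrite eqxx mulr1 addr0.
  by rewrite (negbTE ja) mulr0.
have Px0 : pmap P x = 0 by apply/rowP => i; rewrite !mxE PV.
have Fx : pmap F x = 0 by rewrite FE Px0 mul0mx subrr mul0mx addr0.
have Jx : pjac F x = 1%:M by rewrite JE -/M /K subrKC.
(* [P] is recovered from [F], so a point near [x] lies on [V] as soon as [M] kills the value of [F]
   there. *)
have FM y : pmap F y *m M = pmap P y.
  by rewrite FE mulmxDl -!mulmxA LM KM mulmx1 mulmx0 addr0.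
have Jn : nbhs x [set y | pjac F y \in unitmx].
  have detC : Ck 0 setT (fun y => \det (pjac F y)).
    apply: Ck_det => [|a b]; first exact: openT.
    apply: Ck_eq (Ck_peval 0 (mderiv a (F b)) openT) => [|y _]; first exact: openT.
    by rewrite mxE.
  have := detC x I; rewrite /prop_for /continuous_at Jx det1 => /(_ [set~ 0]).
  have n10 : nbhs (1 : R) [set~ 0].
    apply: open_nbhs_nbhs; split; last exact/eqP/oner_neq0.
    by apply: closed_openC; exact: closed_eq.
  move=> /(_ n10) nx.
  have {}nx : nbhs x [set y | \det (pjac F y) <> 0] := nx.
  by apply: filterS nx => y /= /eqP; rewrite unitmxE unitfE.
have oO : nbhs x O by apply: open_nbhs_nbhs; split=> //; exact: zariski_open_open.
have [rho [psi [rho0 rhoN lip psiK]]] :=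
  pmap_local_inverse Fx Jx (filterI (filterI oO Jn) nN).
have rhoO y : `|y - x| < rho -> O y by move=> /rhoN[[]].
have rhoJ y : `|y - x| < rho -> pjac F y \in unitmx by move=> /rhoN[[]].
have {}rhoN y : `|y - x| < rho -> N y by move=> /rhoN[].
(* The rows of [E] form a basis of the tangent space, of dimension [d]; [E'] reads off the
   coordinates in that basis. *)
have [d [E [E' [EE' EM KE]]]] : exists d (E : 'M[R]_(d, m)) (E' : 'M[R]_(m, d)),
    [/\ E *m E' = 1%:M, E *m M = 0 & forall v : 'rV[R]_m, exists w, v *m K = w *m E].
  have /row_freeP[E' EE'] := row_base_free K; exists (\rank K), (row_base K), E'.
  split=> // [|v]; last by apply/submxP; rewrite eq_row_base submxMl.
  have /submxP[W ->] : (row_base K <= K)%MS by rewrite eq_row_base.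
  by rewrite -mulmxA KM mulmx0.
have Einj : injective (mulmx^~ E : 'rV[R]_d -> 'rV[R]_m).
  by move=> v w /(congr1 (mulmx^~ E')); rewrite -!mulmxA EE' !mulmx1.
pose U := [set t : 'rV[R]_d | `|t *m E| < rho / 2].
pose phi (t : 'rV[R]_d) := psi (t *m E).
have oU : open U by exact: open_ball_image.
have phix t : U t -> `|phi t - x| < rho by move=> /psiK[].
have phiF t : U t -> pmap F (phi t) = t *m E by move=> /psiK[].
have VP y : O y -> V y <-> pmap P y = 0.
  move=> Oy; split=> [Vy|Py].
    by apply/rowP => i; rewrite !mxE PV.
  suff : (V `&` O) y by case.
  rewrite VO; split=> // i.
  by have /rowP/(_ i) := Py; rewrite !mxE.
have phiV t : U t -> V (phi t).
  move=> Ut; apply/VP; first exact/rhoO/phix.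
  by rewrite -FM phiF// -mulmxA EM mulmx0.
have psiF y : `|y - x| < rho -> `|pmap F y| < rho / 2 -> psi (pmap F y) = y.
  move=> yx Fy; have [px pE] := psiK _ Fy.
  apply/eqP; rewrite -subr_eq0 -normr_le0 (le_trans (lip _ _ px yx))//.
  by rewrite pE subrr normr0 mulr0.
have VE y : V y -> `|y - x| < rho -> pmap F y = pmap F y *m E' *m E.
  move=> Vy yx; have [w wE] := KE (y - x).
  have -> : pmap F y = w *m E.
    by rewrite FE (VP y _).1 ?mul0mx ?add0r//; exact: rhoO.
  by rewrite -(mulmxA w E E') EE' mulmx1.
have phiC k (h : 'rV[R]_m -> R) O' : open O' -> (forall t, U t -> O' (phi t)) ->
  Ck k O' h -> Ck k U (h \o phi).
  by move=> oO'; exact: (Ck_comp_inverse rho0 lip psiK rhoJ).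
exists d, U, phi; split=> //; last by move=> t /phix/rhoN.
- split=> //.
  + move=> k; apply: class_C_open_coord => // i.
    exact: (phiC k (fun y => y ord0 i) setT openT (fun _ _ => I) (Ck_coord k i openT)).
  + move=> t Ut; have [_ ->] := inverse_diff rho0 lip psiK rhoJ Ut.
    move=> v w /= vw; apply: Einj.
    have /= := congr1 (mulmxr (pjac F (phi t))) vw.
    by rewrite !mulmxA !mulmxKV//; exact/rhoJ/phix.
  + move=> s t /set_mem Us /set_mem Ut st.
    by apply: Einj; rewrite /= -!phiF// st.
  + move=> U' oU' U'U.
    (* The map y -> F y E' is defined on the ambient space and inverts [phi] on [V], so the preimage
       of [U'] under it is an ambient open set. *)
    exists ([set y | `|y - x| < rho] `&` [set y | `|pmap F y| < rho / 2] `&`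
      [set y | U' (pmap F y *m E')]).
      apply: openI; first apply: openI.
      - apply: open_norm_lt => // y.
        by apply: continuousB; [exact: cvg_id|exact: cst_continuous].
      - by apply: open_norm_lt; [rewrite divr_gt0|exact: pmap_continuous].
      - apply: (open_comp (f := fun y => pmap F y *m E')) => // y _.
        apply: (@continuous_comp _ _ _ (pmap F) (mulmxr E')).
          exact: pmap_continuous.
        exact: mulmxr_continuous.
    apply/seteqP; split=> [_ [t U't <-]|y [Vy [[yx Fy] U'y]]].
      have Ut := U'U _ U't.
      split; first exact: phiV.
      split; first by split => /=; [exact: phix|rewrite phiF//; exact: Ut].
      by rewrite /= phiF// -mulmxA EE' mulmx1.
    exists (pmap F y *m E') => //.
    by rewrite /phi -VE// psiF.
- exists 0; first by rewrite /U/= mul0mx normr0 divr_gt0.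
  by rewrite /phi mul0mx -Fx psiF// ?Fx ?subrr ?normr0 ?divr_gt0.
Qed.

End NonsingularParametrization.

(** * Polynomial approximation *)

Section PolynomialApproximation.
Variables (R : realType) (m : nat).
Implicit Types (V : set 'rV[R]_m) (x y : 'rV[R]_m) (p : mpoly m R).

Lemma compact_seq_cover V (O : 'rV[R]_m -> set 'rV[R]_m) : compact V ->
  (forall y, V y -> open (O y)) -> (forall y, V y -> O y y) ->
  exists s : seq 'rV[R]_m,
    (forall y, y \in s -> V y) /\ forall x, V x -> exists2 y, y \in s & O y x.
Proof.
rewrite compact_cover => Vc oO Oy.
have [|D DV VD] := Vc _ V O oO; first by move=> y Vy; exists y => //; exact: Oy.
exists (finmap.enum_fset D); split=> [y /DV/set_mem//|x /VD[y yD Ox]].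
by exists y.
Qed.

Lemma compact_norm_bounded (W : normedModType R) (T : topologicalType) (V : set T) (f : T -> W) :
  compact V -> {within V, continuous f} -> exists2 M : R, 0 < M & forall z, V z -> `|f z| <= M.
Proof.
move=> Vc fc; have := compact_bounded (continuous_compact fc Vc).
move=> /(ex_strict_bound_gt0)[M M0 VM]; exists M => // z Vz; apply: ltW; apply: VM.
by exists z.
Qed.

Lemma peval_within_continuous V p : {within V, continuous (peval p)}.
Proof. by apply: continuous_subspaceT => x; exact: peval_continuous. Qed.

(** The norm of ['rV[R]_m] is the maximum norm, whose square is not a polynomial; the Euclidean one
    is, and it dominates. *)
Definition sq_dist y : mpoly m R :=
  \sum_j (mpolyX R (mnm1 j) - mpolyC m (y ord0 j)) ^+ 2.

Lemma sq_distE y x : peval (sq_dist y) x = \sum_j (x ord0 j - y ord0 j) ^+ 2.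
Proof.
rewrite peval_sum; apply: eq_bigr => j _.
by rewrite peval_exp pevalB pevalXU pevalC.
Qed.

Lemma sq_dist_norm y x : `|x - y| ^+ 2 <= peval (sq_dist y) x.
Proof.
rewrite sq_distE.
have s0 : 0 <= \sum_j (x ord0 j - y ord0 j) ^+ 2 by apply: sumr_ge0 => j _; exact: sqr_ge0.
rewrite -[leRHS]sqr_sqrtr// lerXn2r ?nnegrE ?sqrtr_ge0//.
apply: row_norm_le => [|j]; first exact: sqrtr_ge0.
rewrite -sqrtr_sqr ler_wsqrtr// !mxE (bigD1 j)//= lerDl.
by apply: sumr_ge0 => i _; exact: sqr_ge0.
Qed.

Lemma exprn_small (b c : R) : 0 <= b < 1 -> 0 < c -> \forall N \near \oo, b ^+ N <= c.
Proof.
move=> /andP[b0 b1] c0.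
have /cvg_expr/cvgrPdist_le/(_ c c0) : `|b| < 1 by rewrite ger0_norm.
apply: filterS => N /=.
by rewrite sub0r normrN ger0_norm// exprn_ge0.
Qed.

Lemma exprn_small_seq (T : eqType) (s : seq T) (b : T -> R) (c : R) : 0 < c ->
  (forall z, z \in s -> 0 <= b z < 1) ->
  \forall N \near \oo, forall z, z \in s -> b z ^+ N <= c.
Proof.
move=> c0; elim: s => [|a s IH] sb; first exact: nearW.
have /IH Hs : forall z, z \in s -> 0 <= b z < 1.
  by move=> z zs; apply: sb; rewrite inE zs orbT.
have Ha := exprn_small (sb a (mem_head a s)) c0.
near=> N; move=> z; rewrite inE => /orP[/eqP->|]; first by near: N.
by move: z; near: N.
Unshelve. all: by end_near. Qed.

(** Truncated geometric series for 1/p: with B an upper bound of p and u = 1 - p/B in [0, 1 - 1/B],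
    the defect 1 - p q is exactly u^N. *)
Lemma peval_approx_inv V (p : mpoly m R) (e : R) : compact V ->
  (forall x, V x -> 1 <= peval p x) -> 0 < e ->
  exists q, forall x, V x -> 0 <= peval q x /\ 0 <= 1 - peval p x * peval q x <= e.
Proof.
move=> Vc p1 e0.
have [B B0 pB] := compact_norm_bounded Vc (@peval_within_continuous V p).
have {}pB x : V x -> peval p x <= B by move=> /pB; exact/le_trans/ler_norm.
(* A point of [V] is what shows [B >= 1]. *)
have [->|/set0P[x0 Vx0]] := eqVneq V set0; first by exists 0.
have B1 : 1 <= B by exact: le_trans (p1 _ Vx0) (pB _ Vx0).
have b01 : 0 <= 1 - B^-1 < 1 by rewrite subr_ge0 invf_le1// B1 ltrBlDr ltrDl invr_gt0.
have [N _ /(_ N (leqnn N)) NB] := exprn_small b01 e0.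
exists (B^-1 *: \sum_(i < N) (1 - B^-1 *: p) ^+ i) => x Vx.
have [px1 pxB] := (p1 x Vx, pB x Vx).
have pE : peval (1 - B^-1 *: p) x = 1 - B^-1 * peval p x.
  by rewrite pevalB pevalZ -[1]mpolyC1 pevalC.
set u := 1 - B^-1 * peval p x in pE.
have u0 : 0 <= u by rewrite subr_ge0 mulrC ler_pdivrMr// mul1r.
have uB : u <= 1 - B^-1 by rewrite lerD2l lerN2 ler_pMr ?invr_gt0.
have -> : peval (B^-1 *: \sum_(i < N) (1 - B^-1 *: p) ^+ i) x = B^-1 * \sum_(i < N) u ^+ i.
  by rewrite pevalZ peval_sum; congr (_ * _); apply: eq_bigr => i _; rewrite peval_exp pE.
split; first by rewrite mulr_ge0 ?invr_ge0 ?(ltW B0)// sumr_ge0// => i _; exact: exprn_ge0.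
have -> : 1 - peval p x * (B^-1 * \sum_(i < N) u ^+ i) = u ^+ N.
  have -> : peval p x * (B^-1 * \sum_(i < N) u ^+ i) = (1 - u) * \sum_(i < N) u ^+ i.
    by rewrite /u; ring.
  by rewrite -[1 - u]opprB mulNr opprK -subrX1 addrC subrK.
rewrite exprn_ge0//= (le_trans _ NB)// lerXn2r// ?nnegrE.
by rewrite subr_ge0 invf_le1.
Qed.

(* Weights [((C - |x - y|^2) / (C - d y)) ^ N]: at least 1 where
   [|x - y|^2 < d y], and uniformly small for large [N] where
   [|x - y|^2 >= 2 d y]. *)
Lemma stone_weierstrass V (f : 'rV[R]_m -> R) (e : R) :
  compact V -> {within V, continuous f} -> 0 < e ->
  exists p, forall x, V x -> `|peval p x - f x| <= e.
Proof.
move=> Vc fc e0.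
have e40 : 0 < e / 4 by rewrite divr_gt0.
have [M M0 fM] := compact_norm_bounded Vc fc.
have /choice[d dP] : forall y, exists d : R, V y -> [/\ 0 < d, d <= 1 &
    forall x, V x -> peval (sq_dist y) x < 2 * d -> `|f y - f x| <= e / 4].
  move=> y; have [Vy|nVy] := pselect (V y); last by exists 0.
  have /(_ y Vy)/cvgrPdist_le/(_ _ e40) := (subspace_continuousP _ _).1 fc.
  rewrite near_withinE => /nbhs_ballP[r /= r0 rP].
  exists (Num.min 1 (r ^+ 2 / 2)) => _; split.
  - by rewrite lt_min ltr01 divr_gt0// exprn_gt0.
  - by rewrite ge_min lexx.
  move=> x Vx dx; apply: rP => //; rewrite -ball_normE /ball_/= distrC.
  rewrite -(@ltr_pXn2r _ 2) ?nnegrE// ?(ltW r0)//.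
  rewrite (le_lt_trans (sq_dist_norm _ _))// (lt_le_trans dx)//.
  by rewrite mulrC -ler_pdivlMr// ge_min lexx orbT.
have [||s [sV Vs]] := compact_seq_cover (O := fun y => [set x | peval (sq_dist y) x < d y]) Vc.
- move=> y _; apply: (open_comp (D := [set t | t < d y])); last exact: open_lt.
  by move=> x _; exact: peval_continuous.
- move=> y /dP[d0 _ _]; rewrite /= sq_distE big1// => j _.
  by rewrite subrr expr0n.
(* [C] bounds the squared distances, so that weights are nonnegative; [2 < C] and [d y <= 1] put the
   ratio [b y] into [0, 1). *)
have [C C0 CP] : exists2 C : R, 2 < C & forall y, y \in s -> forall x, V x -> peval (sq_dist y) x <= C.
  have /choice[B BP] : forall y, exists B : R, 0 < B /\
      forall x, V x -> peval (sq_dist y) x <= B.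
    move=> y; have [B B0 yB] := compact_norm_bounded Vc (@peval_within_continuous V (sq_dist y)).
    by exists B; split=> // x /yB; exact/le_trans/ler_norm.
  have S0 (r : seq 'rV[R]_m) : 0 <= \sum_(y <- r) B y.
    by apply: sumr_ge0 => y _; have [/ltW] := BP y.
  exists (3 + \sum_(y <- s) B y) => [|y ys x Vx]; first by have := S0 s; lra.
  have [_ /(_ x Vx)] := BP y; rewrite (big_rem y)//=; have := S0 (rem y s); lra.
pose v y := (C - d y)^-1 *: (mpolyC m C - sq_dist y).
have vE y x : peval (v y) x = (C - peval (sq_dist y) x) / (C - d y).
  by rewrite pevalZ pevalB pevalC mulrC.
pose b y := (C - 2 * d y) / (C - d y).
have sd y : y \in s -> 0 < d y <= 1 by move=> /sV/dP[-> -> _].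
have sb y : y \in s -> 0 <= b y < 1.
  move=> /sd ?; rewrite /b divr_ge0 ?ltr_pdivrMr /=; lra.
(* Multiplied by the oscillation [2 * M] of [f] and summed over [s], weights below this contribute
   at most [e / 4]. The successor guards against an empty [s]. *)
have eps0 : 0 < e / 4 / (2 * M * (size s).+1%:R) by rewrite !(divr_gt0, mulr_gt0).
have [N _ /(_ N (leqnn N)) NP] := exprn_small_seq eps0 sb.
pose F := \sum_(y <- s) f y *: v y ^+ N.
pose W := \sum_(y <- s) v y ^+ N.
have v0 y x : y \in s -> V x -> 0 <= peval (v y) x.
  move=> ys Vx; rewrite vE divr_ge0 ?subr_ge0 ?CP//.
  have := sd _ ys; lra.
have W1 x : V x -> 1 <= peval W x.
  move=> Vx; have [y ys xy] := Vs x Vx.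
  rewrite peval_sum (big_rem y)//= peval_exp.
  have vy : 1 <= peval (v y) x.
    rewrite vE ler_pdivlMr; have := sd _ ys; move: xy => /=; lra.
  rewrite (le_trans (exprn_ege1 N vy))// lerDl.
  rewrite big_seq; apply: sumr_ge0 => z /mem_rem zs.
  by rewrite peval_exp exprn_ge0// v0.
(* Centres near [x] contribute at most e/4 W, the far ones e/4 in all, and 1 <= W. *)
have FW x : V x -> `|peval F x - f x * peval W x| <= e / 2 * peval W x.
  move=> Vx; have Wx := W1 x Vx.
  rewrite !peval_sum mulr_sumr -sumrB (le_trans (ler_norm_sum _ _ _))//.
  apply: (@le_trans _ _ (\sum_(y <- s) (e / 4 * peval (v y ^+ N) x + e / 4 / (size s).+1%:R))).
    rewrite big_seq [leRHS]big_seq; apply: ler_sum => y ys.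
    have [d0 d1 dx] := dP y (sV y ys).
    have vN0 : 0 <= peval (v y ^+ N) x by rewrite peval_exp exprn_ge0// v0.
    rewrite pevalZ -mulrBl normrM (ger0_norm vN0).
    have [xy|xy] := ltP (peval (sq_dist y) x) (2 * d y).
      rewrite -[leLHS]addr0 lerD ?ler_wpM2r ?dx//.
      by rewrite !divr_ge0// ltW.
    rewrite -[leLHS]add0r lerD//; first by rewrite mulr_ge0// ltW.
    have fM2 : `|f y - f x| <= 2 * M.
      rewrite (le_trans (ler_normB _ _))//.
      have := fM _ Vx; have := fM _ (sV y ys); lra.
    apply: le_trans (_ : 2 * M * (e / 4 / (2 * M * (size s).+1%:R)) <= _).
      apply: ler_pM => //.
      apply: le_trans (NP y ys); rewrite peval_exp lerXn2r ?nnegrE ?v0//.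
        by have /andP[] := sb y ys.
      rewrite vE /b ler_wpM2r// ?invr_ge0; have := sd _ ys; lra.
    rewrite le_eqVlt; apply/orP; left; apply/eqP; field.
    by rewrite (gt_eqF M0) addr_eq0 gt_eqF// (lt_le_trans (ltrN10 _)).
  move: Wx; rewrite peval_sum big_split/= -mulr_sumr => Wx.
  rewrite big_const_seq count_predT iter_addr_0.
  have : e / 4 / (size s).+1%:R *+ size s <= e / 4.
    rewrite -mulr_natr -mulrA ler_piMr ?(ltW e40)// mulrC ler_pdivrMr// mul1r.
    by rewrite ler_nat.
  have := ler_peMr (ltW e40) Wx; move: (\sum_(y <- s) _) (_ / (size s).+1%:R *+ _) => S T; lra.
(* The approximation wanted is F / W; [q] stands for 1 / W. Its tolerance is divided by [M] because
   its error gets multiplied by [f]. *)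
have [q qP] := peval_approx_inv Vc W1 (divr_gt0 e40 M0).
exists (F * q) => x Vx; rewrite pevalM.
have [q0 /andP[Wq0 Wq]] := qP x Vx.
have -> : peval F x * peval q x - f x =
  (peval F x - f x * peval W x) * peval q x - f x * (1 - peval W x * peval q x) by ring.
rewrite (le_trans (ler_normB _ _))// !normrM (ger0_norm q0) (ger0_norm Wq0).
have h1 : `|peval F x - f x * peval W x| * peval q x <= e / 2.
  apply: le_trans (ler_wpM2r q0 (FW x Vx)) _.
  rewrite -[leLHS]mulrA ler_piMr ?divr_ge0 ?(ltW e0)//; lra.
have h2 : `|f x| * (1 - peval W x * peval q x) <= e / 4.
  apply: le_trans (ler_pM _ _ (fM x Vx) Wq) _ => //.
  by rewrite mulrCA divff ?mulr1// gt_eqF.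
lra.
Qed.

End PolynomialApproximation.

(** * Collapsing a half space to a pole *)

Section TruncatedPower.
Variable R : realType.

Lemma max0_sq_remainder (x y : R) :
  `|Num.max 0 y ^+ 2 - Num.max 0 x ^+ 2 - 2 * Num.max 0 x * (y - x)| <= (y - x) ^+ 2.
Proof.
rewrite ler_norml; have xy2 := sqr_ge0 (y - x).
have [x2 y2] := (sqr_ge0 x, sqr_ge0 y).
case: (leP 0 x) => x0; case: (leP 0 y) => y0; apply/andP; split; try lra.
- have : 0 <= x * - y by rewrite mulr_ge0// oppr_ge0 ltW.
  lra.
- have : 0 <= - x * y by rewrite mulr_ge0// oppr_ge0 ltW.
  lra.
Qed.

Lemma max0_sq_diff (x : R) : differentiable (fun z : R => Num.max 0 z ^+ 2) x /\
  'd (fun z : R => Num.max 0 z ^+ 2) x = *:%R (2 * Num.max 0 x) :> (R -> R).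
Proof.
apply: diff_epsilon => [y|e e0]; first exact: scaler_continuous.
near=> y; have yx : `|y - x| <= e.
  rewrite distrC; near: y.
  by apply: (@cvgr_dist_le _ _ _ (nbhs x) _ id) => //; exact: cvg_id.
have : `|Num.max 0 y ^+ 2 - Num.max 0 x ^+ 2 - 2 * Num.max 0 x * (y - x)| <= `|y - x| ^+ 2.
  by rewrite [leRHS]real_normK ?num_real// max0_sq_remainder.
by move/le_trans; apply; rewrite expr2 ler_wpM2r.
Unshelve. all: by end_near. Qed.

Variable V : normedModType R.

(** From the square on, one more factor max(0, r) may be replaced by [r], since the other factors
    vanish where they differ; the product rule then does the induction. *)
Lemma max0_exp_diff (r : V -> R) x n : differentiable r x ->
  differentiable (fun y => Num.max 0 (r y) ^+ n.+2) x /\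
  forall v, 'D_v (fun y => Num.max 0 (r y) ^+ n.+2) x =
    n.+2%:R * Num.max 0 (r x) ^+ n.+1 * 'D_v r x.
Proof.
move=> rd; elim: n => [|n [IHd IHD]].
  have [Fd FE] := max0_sq_diff (r x).
  have cd := differentiable_comp rd Fd; split=> // v.
  by rewrite deriveE// (diff_comp rd Fd)/= FE deriveE// expr1.
have E : (fun y => Num.max 0 (r y) ^+ n.+3) = (fun y => Num.max 0 (r y) ^+ n.+2) * r.
  apply/funext => y; rewrite fctE exprSr; case: (leP 0 (r y)) => //.
  by rewrite exprS !mul0r.
split=> [|v]; rewrite E; first exact: differentiableM.
rewrite deriveM; [|exact: diff_derivable..]; rewrite IHD.
rewrite /GRing.scale/= [n.+3%:R]mulrSr exprS.
case: (leP 0 (r x)) => r0; first by ring.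
by rewrite [0 ^+ n.+1]exprS !mul0r; ring.
Qed.

(** Each derivative lowers the exponent by one, and exponent 1 is still continuous: this is where
    the exponent k + 1 comes from. *)
Lemma Ck_max0_exp (U : set V) (r : V -> R) : open U ->
  (forall k, Ck k U r) -> forall k, Ck k U (fun y => Num.max 0 (r y) ^+ k.+1).
Proof.
move=> oU rC; elim=> [|k IH].
  move=> x Ux; have := continuous_max (@cst_continuous _ _ (0 : R) x) (rC 0 x Ux).
  by congr continuous_at; apply/funext => y; rewrite expr1.
have rd x : U x -> differentiable r x by have [rd _] := rC 1; exact: rd.
split=> [x Ux|v]; first by have [] := max0_exp_diff k (rd x Ux).
have [_ /(_ v) rDv] := rC k.+1.
apply: Ck_eq (CkM oU (CkM oU (Ck_cst k U k.+2%:R) IH) rDv) => // x Ux.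
by have [_ ->] := max0_exp_diff k (rd x Ux).
Qed.

End TruncatedPower.

Section Collapse.
Variables (R : realType) (n : nat).
Implicit Types (a u : 'rV[R]_n.+1) (c : R).

Definition tail_sq a : R := \sum_(i | i != ord0) a ord0 i ^+ 2.

(** Homogeneous in (a', c), so [c = 0] is admissible when a' <> 0 and gives the pole (1, 0). *)
Definition fold_map c a : 'rV[R]_n.+1 :=
  \row_i ((if i == ord0 then tail_sq a - c ^+ 2 else 2 * c * a ord0 i) /
          (tail_sq a + c ^+ 2)).

(* Collapses the half space [0 <= a0] to the pole [(1, 0)]; elsewhere it is
   inverse stereographic projection of [a' / c], where [c = (-2 a0)^N] and
   [a = (a0, a')]. *)
Definition collapse (N : nat) a : 'rV[R]_n.+1 :=
  if 0 <= a ord0 ord0 then delta_mx ord0 ord0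
  else fold_map ((- 2 * a ord0 ord0) ^+ N) a.

Lemma tail_sq_ge0 a : 0 <= tail_sq a.
Proof. by apply: sumr_ge0 => i _; exact: sqr_ge0. Qed.

Lemma sum_sq_split a : \sum_i a ord0 i ^+ 2 = a ord0 ord0 ^+ 2 + tail_sq a.
Proof. by rewrite (bigD1 ord0). Qed.

Lemma fold_map_head c a :
  fold_map c a ord0 ord0 = (tail_sq a - c ^+ 2) / (tail_sq a + c ^+ 2).
Proof. by rewrite mxE eqxx. Qed.

Lemma tail_sq_fold_map c a :
  tail_sq (fold_map c a) = (2 * c / (tail_sq a + c ^+ 2)) ^+ 2 * tail_sq a.
Proof.
rewrite {1}/tail_sq /tail_sq mulr_sumr; apply: eq_bigr => i i0.
by rewrite mxE (negbTE i0) /tail_sq; ring.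
Qed.

Lemma fold_map_sphere c a : tail_sq a + c ^+ 2 != 0 -> unit_sphere R n (fold_map c a).
Proof.
move=> D0; rewrite /unit_sphere/= sum_sq_split fold_map_head tail_sq_fold_map.
by move: (tail_sq a) D0 => q D0; field.
Qed.

Lemma delta_sphere : unit_sphere R n (delta_mx ord0 ord0).
Proof.
rewrite /unit_sphere/= sum_sq_split mxE !eqxx expr1n /tail_sq big1 ?addr0// => i i0.
by rewrite mxE (negbTE i0) andbF expr0n.
Qed.

Lemma fold_map_denominator_gt0 N a : a ord0 ord0 != 0 ->
  0 < tail_sq a + ((- 2 * a ord0 ord0) ^+ N) ^+ 2.
Proof.
move=> a0; rewrite ltr_wpDl ?tail_sq_ge0// exprn_even_gt0//= expf_neq0//.
by rewrite mulf_neq0// oppr_eq0.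
Qed.

Lemma collapse_sphere N a : unit_sphere R n (collapse N a).
Proof.
rewrite /collapse; case: leP => a0; first exact: delta_sphere.
by apply: fold_map_sphere; rewrite gt_eqF// fold_map_denominator_gt0// lt_eqF.
Qed.

(** A single formula on both sides of a0 = 0, on which differentiability there rests. The exponent
    must be positive: the truncated power has to vanish where 0 <= a0. *)
Lemma collapseE N a :
  tail_sq a + (Num.max 0 (- 2 * a ord0 ord0) ^+ N.+1) ^+ 2 != 0 ->
  collapse N.+1 a = fold_map (Num.max 0 (- 2 * a ord0 ord0) ^+ N.+1) a.
Proof.
rewrite /collapse; case: (leP 0 (a ord0 ord0)) => a0; last first.
  rewrite (max_idPr _)//; lra.
rewrite (max_idPl _); last lra.
rewrite expr0n/= expr0n/= addr0 => q0; apply/rowP => i; rewrite !mxE eqxx/=.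
case: eqP => _; first by rewrite expr0n/= subr0 addr0 divff.
by rewrite mulr0 !mul0r.
Qed.

Lemma collapse_antipodal N a u : unit_sphere R n u ->
  \sum_i (a ord0 i - u ord0 i) ^+ 2 < 16^-1 -> collapse N a <> - u.
Proof.
rewrite /unit_sphere/= sum_sq_split => u1 au.
have : \sum_i (a - u) ord0 i ^+ 2 < 16^-1.
  by rewrite (eq_bigr (fun i => (a ord0 i - u ord0 i) ^+ 2)) // => i _; rewrite !mxE.
rewrite sum_sq_split [(a - u) _ _]mxE [(- u) _ _]mxE => {}au Cu.
have tq := tail_sq_ge0 (a - u).
move: Cu; rewrite /collapse; case: (leP 0 (a ord0 ord0)) => a0 Cu.
  have := congr1 (fun w : 'rV[R]_n.+1 => w ord0 ord0) Cu; rewrite !mxE !eqxx/= => u0.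
  nra.
set c := _ ^+ N in Cu.
have D0 := fold_map_denominator_gt0 N (ltr0_neq0 a0); rewrite -/c in D0.
have c0 : 0 <= c by rewrite exprn_ge0//; lra.
pose l := 2 * c / (tail_sq a + c ^+ 2).
have l0 : 0 <= l by rewrite divr_ge0 ?mulr_ge0// ltW.
(* Hence a' - u' = (1 + l) a' with l >= 0, so neither a' nor u' is longer than a' - u'. *)
have ul i : i != ord0 -> u ord0 i = - l * a ord0 i.
  move=> i0; have := congr1 (fun w : 'rV[R]_n.+1 => w ord0 i) Cu.
  by rewrite !mxE (negbTE i0) /l => /(congr1 -%R); rewrite opprK => <-; ring.
have tE : tail_sq (a - u) = (1 + l) ^+ 2 * tail_sq a.
  rewrite /tail_sq mulr_sumr; apply: eq_bigr => i i0.
  by rewrite !mxE ul//; ring.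
have uE : tail_sq u = l ^+ 2 * tail_sq a.
  by rewrite /tail_sq mulr_sumr; apply: eq_bigr => i i0; rewrite ul//; ring.
have u0 : u ord0 ord0 = (c ^+ 2 - tail_sq a) / (tail_sq a + c ^+ 2).
  have := congr1 (fun w : 'rV[R]_n.+1 => w ord0 ord0) Cu; rewrite fold_map_head.
  rewrite mxE => /(congr1 -%R); rewrite opprK => <-; ring.
have qa := tail_sq_ge0 a.
have a0u0 := sqr_ge0 (a ord0 ord0 - u ord0 ord0).
have lq : 0 <= l * tail_sq a by exact: mulr_ge0.
have llq : 0 <= l ^+ 2 * tail_sq a by rewrite mulr_ge0// sqr_ge0.
have qsmall : tail_sq a < 16^-1 by lra.
have usmall : tail_sq u < 16^-1 by lra.
have h0 : (a ord0 ord0 - u ord0 ord0) ^+ 2 < 16^-1 by lra.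
(* Since u' is short, u0^2 > 15/16; the positive value is excluded by a0 < 0 and |a0 - u0| < 1/4. *)
have u0neg : u ord0 ord0 < - (3 / 4).
  rewrite ltNge; apply/negP => u34; have {}u34 : 3 / 4 < u ord0 ord0.
    rewrite ltNge; apply/negP => u34'.
    have : 0 <= (u ord0 ord0 + 3 / 4) * (3 / 4 - u ord0 ord0) by rewrite mulr_ge0//; lra.
    lra.
  have : 0 <= (u ord0 ord0 - a ord0 ord0 - 3 / 4) * (u ord0 ord0 - a ord0 ord0 + 3 / 4).
    by rewrite mulr_ge0//; lra.
  lra.
(* Now -2 a0 > 1, so [c >= 1] for every [N]. As |a'|^2 < 1/16, the image has negative first
   coordinate, against u0 < 0. *)
have a0neg : a ord0 ord0 < - 2^-1.
  rewrite ltNge; apply/negP => a12.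
  have : 0 <= (a ord0 ord0 - u ord0 ord0 - 4^-1) * (a ord0 ord0 - u ord0 ord0 + 4^-1).
    by rewrite mulr_ge0//; lra.
  lra.
have c1 : 1 <= c by rewrite exprn_ege1//; lra.
have c2 : 1 <= c ^+ 2 by exact: exprn_ege1.
have : 0 <= u ord0 ord0 by rewrite u0 divr_ge0 ?(ltW D0)//; lra.
lra.
Qed.

End Collapse.

(** * Regularity on connected components of strata *)

Section Zariski.
Variables (R : realType) (m : nat).
Implicit Types (V X Z : set 'rV[R]_m) (p : mpoly m R).

Lemma algebraic_set_zero p : algebraic_set [set x : 'rV[R]_m | peval p x = 0].
Proof.
exists [set p]; apply/seteqP; split=> [x px _ ->//|x]; exact.
Qed.

Lemma algebraic_set0 : algebraic_set (set0 : set 'rV[R]_m).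
Proof.
exists [set 1]; apply/seteqP; split=> // x /(_ 1 erefl).
by rewrite -mpolyC1 pevalC => /eqP; rewrite oner_eq0.
Qed.

Lemma algebraic_setT : algebraic_set (setT : set 'rV[R]_m).
Proof. by exists set0; apply/seteqP; split=> // x _ p []. Qed.

Lemma zariski_openT : zariski_open (setT : set 'rV[R]_m).
Proof. by rewrite /zariski_open setCT; exact: algebraic_set0. Qed.

Lemma zariski_open_neq0 p : zariski_open [set x : 'rV[R]_m | peval p x != 0].
Proof.
rewrite /zariski_open (_ : ~` _ = [set x | peval p x = 0]); first exact: algebraic_set_zero.
by apply/seteqP; split => x /=; [move/negP; rewrite negbK => /eqP|move=> ->; rewrite eqxx].
Qed.

Lemma sub_zariski_closure_in V X : X `<=` V -> X `<=` zariski_closure_in V X.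
Proof. by move=> XV x Xx; split=> [|A [_ XA]]; [exact: XV|exact: XA]. Qed.

(** The Zariski closure of [X] may reach across the zero set of [p], so the quotient must take
    values in [W] wherever [p] does not vanish, although it equals [g] only on [X]. *)
Lemma regular_on_quotient V X l (W : set 'rV[R]_l) (g : 'rV[R]_m -> 'rV[R]_l)
    p (P : 'I_l -> mpoly m R) (Q : mpoly m R) : X `<=` V ->
  (forall x, X x -> peval p x != 0) ->
  (forall x, peval p x != 0 -> peval Q x != 0) ->
  (forall x, peval p x != 0 -> W (\row_i (peval (P i) x / peval Q x))) ->
  (forall x, X x -> g x = \row_i (peval (P i) x / peval Q x)) ->
  regular_on V X W g.
Proof.
move=> XV Xp pQ WPQ gE.
exists (zariski_closure_in V X `&` [set x | peval p x != 0]),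
  (fun x => \row_i (peval (P i) x / peval Q x)); split=> [x Xx||| x /gE//].
- by split; [exact: sub_zariski_closure_in|exact: Xp].
- by exists [set x | peval p x != 0] => //; exact: zariski_open_neq0.
split=> [x [_ /WPQ]//|i x [_ px]].
exists [set x | peval p x != 0], (P i), Q; split=> //; first exact: zariski_open_neq0.
by move=> y _ py; rewrite mxE; split=> //; exact: pQ.
Qed.

Lemma regular_on_cst V X l (W : set 'rV[R]_l) (g : 'rV[R]_m -> 'rV[R]_l) u :
  X `<=` V -> W u -> (forall x, X x -> g x = u) -> regular_on V X W g.
Proof.
move=> XV Wu gu.
have p1 x : peval (1 : mpoly m R) x = 1 by rewrite -mpolyC1 pevalC.
have uE x : (\row_i (peval (mpolyC m (u ord0 i)) x / peval (1 : mpoly m R) x)) = u.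
  by apply/rowP => i; rewrite mxE pevalC p1 divr1.
apply: (regular_on_quotient (p := 1) (P := fun i => mpolyC m (u ord0 i)) (Q := 1)) => // x.
- by rewrite p1 oner_neq0.
- by rewrite uE.
- by move=> Xx; rewrite uE gu.
Qed.

(** Intermediate value theorem on a connected component; it selects one of the two formulas for each
    component of the stratum. *)
Lemma peval_component_sign V p x : (forall y, V y -> peval p y != 0) ->
  forall y z, connected_component V x y -> connected_component V x z ->
  0 <= peval p y -> 0 <= peval p z.
Proof.
move=> p0 y z Cy Cz py; rewrite leNgt; apply/negP => pz.
have Cc : connected (peval p @` connected_component V x).
  apply: connected_continuous_connected; first exact: component_connected.
  exact: peval_within_continuous.
have /connected_intervalP/(_ (peval p z) (peval p y)) := Cc.
move=> /(_ (ex_intro2 _ _ z Cz erefl) (ex_intro2 _ _ y Cy erefl) 0).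
rewrite py (ltW pz) => /(_ isT)[w Cw /eqP].
by apply/negP/p0; exact: connected_component_sub Cw.
Qed.

End Zariski.

(** * Homotopy of maps into the sphere that are nowhere antipodal *)

Section StraightLineHomotopy.
Variables (R : realType) (m n : nat).
Implicit Types (V : set 'rV[R]_m) (f g : 'rV[R]_m -> 'rV[R]_n.+1).

Lemma cvg_coord (T : Type) (F : set_system T) (h : T -> 'rV[R]_n.+1) (l : 'rV[R]_n.+1) i :
  Filter F ->
  h x @[x --> F] --> l -> h x ord0 i @[x --> F] --> l ord0 i.
Proof. by move=> FF hl; exact: (cvg_comp _ _ hl (@coord_continuous R 1 n.+1 ord0 i l)). Qed.

Lemma homotopic_sphere V f g :
  continuous_map V (unit_sphere R n) f -> continuous_map V (unit_sphere R n) g ->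
  (forall x, V x -> g x <> - f x) -> homotopic V (unit_sphere R n) f g.
Proof.
move=> [fS fc] [gS gc] fg.
pose c (z : 'rV[R]_m * R) : 'rV[R]_n.+1 := (1 - z.2) *: f z.1 + z.2 *: g z.1.
pose S z := \sum_i c z ord0 i ^+ 2.
have S0 x t : V x -> 0 <= t <= 1 -> 0 < S (x, t).
  move=> Vx t01; rewrite lt_neqAle; apply/andP; split; last first.
    by apply: sumr_ge0 => i _; exact: sqr_ge0.
  apply/negP => /eqP/esym S0.
  have c0 i : (1 - t) * f x ord0 i = - (t * g x ord0 i).
    have : c (x, t) ord0 i ^+ 2 = 0.
      by apply: (psumr_eq0P _ S0) => // j _; exact: sqr_ge0.
    move=> /eqP; rewrite sqrf_eq0 => /eqP; rewrite /c !mxE/= => h.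
    by apply/eqP; rewrite -subr_eq0 opprK h.
  (* If the segment meets 0, unit lengths force (1 - t)^2 = t^2, so t = 1/2 and g = - f. *)
  have : \sum_i ((1 - t) * f x ord0 i) ^+ 2 = \sum_i (t * g x ord0 i) ^+ 2.
    by apply: eq_bigr => i _; rewrite c0 sqrrN.
  have fx := fS x Vx; have gx := gS x Vx; rewrite /unit_sphere/= in fx gx.
  under eq_bigr do rewrite exprMn; rewrite -mulr_sumr fx.
  under eq_bigr do rewrite exprMn; rewrite -mulr_sumr gx !mulr1 => tt.
  have t2 : t = 2^-1 by lra.
  apply: (fg x Vx); apply/rowP => i; rewrite mxE; have := c0 i; rewrite t2; lra.
exists (fun z => (Num.sqrt (S z))^-1 *: c z); split.
- apply/subspace_continuousP => -[x t] [/= Vx t01].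
  set F := within _ _.
  (* Continuity of [f] and [g] is known only within [V], so the projection has to converge in the
     restricted filter. *)
  have F1 : z.1 @[z --> F] --> within V (nbhs x).
    move=> A VA; exists ([set y | V y -> A y], setT).
      by split=> //; exact: filterT.
    by move=> z [/= zA _] [Vz _]; exact: zA.
  have F2 : z.2 @[z --> F] --> t.
    move=> A tA; exists (setT, A); first by split=> //; exact: filterT.
    by move=> z [_ zA] _.
  have Ff : f z.1 @[z --> F] --> f x.
    exact: (cvg_comp _ _ F1 ((subspace_continuousP _ _).1 fc x Vx)).
  have Fg : g z.1 @[z --> F] --> g x.
    exact: (cvg_comp _ _ F1 ((subspace_continuousP _ _).1 gc x Vx)).
  have Fc : c z @[z --> F] --> c (x, t).
    apply: cvgD; apply: cvgZ => //.
    by apply: cvgB => //; exact: cvg_cst.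
  have FS : S z @[z --> F] --> S (x, t).
    by apply: cvg_big => [|i _]; [exact: add_continuous|apply: cvgM; exact: cvg_coord].
  apply: cvgZ => //; apply: cvgV.
    by rewrite sqrtr_eq0 -ltNge S0//; move: t01; rewrite set_itvE/=.
  by apply: (cvg_comp _ _ FS); exact: sqrt_continuous.
- move=> x t Vx /=; rewrite in_itv/= => t01; have := S0 x t Vx t01.
  rewrite /unit_sphere/= => St.
  under eq_bigr do rewrite mxE exprMn; rewrite -mulr_sumr exprVn sqr_sqrtr ?ltW// mulVf//.
  by rewrite gt_eqF.
- move=> x Vx; have := fS x Vx; rewrite /unit_sphere/= => fx.
  have cE : c (x, 0) = f x by rewrite /c/= subr0 scale1r scale0r addr0.
  by rewrite /S cE fx sqrtr1 invr1 scale1r.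
- move=> x Vx; have := gS x Vx; rewrite /unit_sphere/= => gx.
  have cE : c (x, 1) = g x by rewrite /c/= subrr scale0r add0r scale1r.
  by rewrite /S cE gx sqrtr1 invr1 scale1r.
Qed.

End StraightLineHomotopy.

(** * Smoothness of the collapsed polynomial map *)

Section CollapsedPolynomialMap.
Variables (R : realType) (m n : nat) (p : 'I_n.+1 -> mpoly m R).
Implicit Types (V : set 'rV[R]_m) (x y : 'rV[R]_m).

Lemma Ck_pmap k (U : set 'rV[R]_m) i : open U -> Ck k U (fun y => pmap p y ord0 i).
Proof. by move=> oU; apply: Ck_eq (Ck_peval k (p i) oU) => // y _; rewrite mxE. Qed.

(** Where P0 > 0 the map is locally constant. Otherwise the denominator is nonzero at [x]: s > 0 if
    P0 < 0, and P' <> 0 if P0 = 0. *)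
Lemma Ck_collapse k x : pmap p x <> 0 -> exists2 N : set 'rV[R]_m, open N /\ N x &
  forall i, Ck k N (fun y => collapse k.+1 (pmap p y) ord0 i).
Proof.
move=> px0; have [p0|p0] := ltP 0 (pmap p x ord0 ord0).
  have oN : open [set y | 0 < pmap p y ord0 ord0].
    apply: (open_comp (f := fun y => pmap p y ord0 ord0) (D := [set t | 0 < t])); last exact: open_gt.
    by move=> y _; exact: (Ck_pmap 0 ord0 openT).
  exists [set y | 0 < pmap p y ord0 ord0] => // i.
  apply: Ck_eq (Ck_cst k _ ((delta_mx ord0 ord0 : 'rV[R]_n.+1) ord0 i)) => // y /= y0.
  by rewrite /collapse ltW.
pose s y := Num.max 0 (- 2 * pmap p y ord0 ord0) ^+ k.+1.
pose q y := tail_sq (pmap p y).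
have sC : Ck k setT s.
  apply: Ck_max0_exp => [|j]; first exact: openT.
  exact: (CkM openT (Ck_cst j setT (- 2)) (Ck_pmap j ord0 openT)).
have qC : Ck k setT q.
  exact: (Ck_sum _ openT (fun i _ => CkX 2 openT (Ck_pmap k i openT))).
have DC : Ck k setT (fun y => q y + s y ^+ 2) by exact: (CkD openT qC (CkX 2 openT sC)).
(* [N] may contain points with P0 > 0; [collapseE] covers them too. *)
pose N := [set y | q y + s y ^+ 2 != 0].
have oN : open N.
  apply: (open_comp (f := fun y => q y + s y ^+ 2) (D := [set t | t != 0])).
    by move=> y _; exact: Ck0 DC y I.
  rewrite (_ : [set t | _] = ~` [set 0]); first by apply: closed_openC; exact: closed_eq.
  by apply/seteqP; split => t /eqP.
have Nx : N x.
  rewrite /N/= /s /q; have [p0'|p0'] := eqVneq (pmap p x ord0 ord0) 0.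
    rewrite p0' mulr0 maxxx expr0n/= expr0n/= addr0; apply/eqP => tail0.
    apply: px0; apply/rowP => i; rewrite [RHS]mxE; have [->//|i0] := eqVneq i ord0.
    apply/eqP; rewrite -sqrf_eq0; apply/eqP.
    exact: (psumr_eq0P (fun j _ => sqr_ge0 _) tail0).
  have pneg : pmap p x ord0 ord0 < 0 by rewrite lt_neqAle p0'.
  by rewrite (max_idPr _) ?gt_eqF ?fold_map_denominator_gt0//; lra.
exists N => // i.
have sub k' h : Ck k' setT h -> Ck k' N h by exact: Ck_subset.
have DVC : Ck k N (fun y => (q y + s y ^+ 2)^-1) by apply: CkV => //; exact: sub.
apply: (Ck_eq (f := fun y => (if i == ord0 then q y - s y ^+ 2
    else 2 * s y * pmap p y ord0 i) / (q y + s y ^+ 2))) => // [y Ny|].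
  by rewrite collapseE// [RHS]mxE.
case: (i == ord0).
  apply: (CkM oN _ DVC); apply: sub.
  apply: Ck_eq (CkD openT qC (CkM openT (Ck_cst k setT (-1)) (CkX 2 openT sC))) => [|y _].
    exact: openT.
  by rewrite mulN1r.
apply: (CkM oN _ DVC); apply: sub.
exact: (CkM openT (CkM openT (Ck_cst k setT 2) sC) (Ck_pmap k i openT)).
Qed.

End CollapsedPolynomialMap.

Theorem theorem1p6 (R : realType) (m : nat) (V : set 'rV[R]_m)
    (V_algebraic : algebraic_set V) (V_compact : compact V)
    (V_nonsingular : nonsingular V)
    (n : nat) (n_gt0 : (0 < n)%N)
    (f : 'rV[R]_m -> 'rV[R]_n.+1)
    (f_continuous : continuous_map V (unit_sphere R n) f) :
  exists SS : set (set 'rV[R]_m),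
    stratification V SS /\
    forall k : nat, exists g : 'rV[R]_m -> 'rV[R]_n.+1,
      [/\ homotopic V (unit_sphere R n) f g,
          piecewise_regular V SS (unit_sphere R n) g
        & class_C k V g].
Proof.
have [fS fc] := f_continuous.
(* Then (n + 1) e^2 = e / 8 <= 1/64, below the 1/16 that [collapse_antipodal] asks for. *)
pose e : R := (8 * n.+1%:R)^-1.
have e0 : 0 < e by rewrite invr_gt0 mulr_gt0.
have /choice[p pP] : forall i, exists p : mpoly m R,
    forall x, V x -> `|peval p x - f x ord0 i| <= e.
  move=> i; apply: stone_weierstrass => //.
  apply/subspace_continuousP => x Vx; apply: cvg_coord.
  exact: ((subspace_continuousP _ _).1 fc x Vx).
have pf x : V x -> \sum_i (pmap p x ord0 i - f x ord0 i) ^+ 2 < 16^-1.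
  move=> Vx; apply: (@le_lt_trans _ _ (\sum_(i < n.+1) e ^+ 2)).
    apply: ler_sum => i _; rewrite mxE -[leLHS]real_normK ?num_real//.
    by rewrite lerXn2r ?nnegrE ?pP// ltW.
  rewrite sumr_const card_ord -[ltLHS]mulr_natr.
  have n1 : 1 <= n.+1%:R :> R by rewrite ler1n.
  have eN : e * n.+1%:R = 8^-1 by rewrite /e invfM mulfVK// pnatr_eq0.
  have e8 : e <= 8^-1 by rewrite -eN ler_peMr// ltW.
  by rewrite expr2 -mulrA eN; lra.
have p_neq0 x : V x -> pmap p x <> 0.
  move=> Vx px0; have := pf x Vx; have := fS x Vx; rewrite px0 /unit_sphere/=.
  by under [X in X < _]eq_bigr do rewrite mxE sub0r sqrrN; move=> ->; lra.
pose S1 := V `&` [set x | peval (p ord0) x != 0].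
pose S2 := V `&` [set x | peval (p ord0) x = 0].
have S1V : S1 `<=` V by move=> x [].
have S2V : S2 `<=` V by move=> x [].
exists [set S1; S2]; split.
  split.
  - exact: finite_set2.
  - move=> _ _ [->|->] [->|->] // [z [[_ /= z1] [_ /= z2]]].
      by rewrite z2 eqxx in z1.
    by rewrite z1 eqxx in z2.
  - rewrite bigcup_setU !bigcup_set1; apply/seteqP; split=> [x [[]|[]]//|x Vx].
    by have [px|px] := eqVneq (peval (p ord0) x) 0; [right|left].
  - move=> S [->|->].
      exists setT, [set x | peval (p ord0) x != 0]; rewrite setIT.
      by split=> //; [exact: algebraic_setT|exact: zariski_open_neq0].
    exists [set x | peval (p ord0) x = 0], setT; rewrite setIT.
    by split=> //; [exact: algebraic_set_zero|exact: zariski_openT].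
move=> k; pose g x := collapse k.+1 (pmap p x).
have gC : continuous_map V (unit_sphere R n) g.
  split=> [x _|]; first exact: collapse_sphere.
  apply/subspace_continuousP => x Vx; apply: cvg_within_filter.
  have [N [oN Nx] NC] := Ck_collapse k (p_neq0 x Vx).
  by apply: continuous_row => i; exact: Ck0 (NC i) x Nx.
have g_pole x : 0 <= peval (p ord0) x -> g x = delta_mx ord0 ord0.
  by move=> px; rewrite /g /collapse mxE px.
exists g; split.
- apply: homotopic_sphere => // x Vx.
  by apply: collapse_antipodal; [exact: fS|exact: pf].
- split=> // S [->|->] x Sx.
    have CV : connected_component S1 x `<=` V.
      by apply: subset_trans S1V; exact: connected_component_sub.
    have Cx : connected_component S1 x x by exact: connected_component_refl.
    have sgn := @peval_component_sign _ _ S1 (p ord0) x (fun y => @proj2 _ _).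
    have [px|px] := leP 0 (peval (p ord0) x).
      apply: (regular_on_cst (u := delta_mx ord0 ord0)) => //; first exact: delta_sphere.
      by move=> z Cz; apply: g_pole; exact: sgn Cx Cz px.
    have neg z : connected_component S1 x z -> peval (p ord0) z < 0.
      by move=> Cz; rewrite ltNge; apply/negP => /(sgn _ _ Cz Cx); rewrite leNgt px.
    (* The plain power replaces the truncated one: it is a polynomial, equal to it where P0 < 0, and
       keeps the quotient on the sphere wherever P0 <> 0. *)
    pose c := (- 2 *: p ord0) ^+ k.+1.
    pose q := \sum_(i | i != ord0) p i ^+ 2.
    pose P i := if i == ord0 then q - c ^+ 2 else 2 *: (c * p i).
    have cE y : peval c y = (- 2 * pmap p y ord0 ord0) ^+ k.+1.
      by rewrite peval_exp pevalZ mxE.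
    have qE y : peval q y = tail_sq (pmap p y).
      by rewrite peval_sum; apply: eq_bigr => i _; rewrite peval_exp mxE.
    have QE y : peval (q + c ^+ 2) y =
        tail_sq (pmap p y) + ((- 2 * pmap p y ord0 ord0) ^+ k.+1) ^+ 2.
      by rewrite pevalD peval_exp qE cE.
    have PQE y : \row_i (peval (P i) y / peval (q + c ^+ 2) y) =
        fold_map ((- 2 * pmap p y ord0 ord0) ^+ k.+1) (pmap p y).
      apply/rowP => i; rewrite mxE [RHS]mxE -QE; congr (_ / _).
      rewrite /P; case: eqP => _; first by rewrite pevalB peval_exp qE cE.
      by rewrite pevalZ pevalM cE [pmap p y ord0 i]mxE mulrA.
    have Q0 y : peval (p ord0) y != 0 -> peval (q + c ^+ 2) y != 0.
      move=> py; rewrite QE gt_eqF// fold_map_denominator_gt0//.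
      by rewrite mxE.
    apply: (regular_on_quotient (p := p ord0) (P := P) (Q := q + c ^+ 2)) => //.
    + by move=> z /neg/ltr0_neq0.
    + by move=> y py; rewrite PQE; apply: fold_map_sphere; rewrite -QE; exact: Q0.
    + by move=> z /neg pz; rewrite PQE /g /collapse mxE leNgt pz.
  apply: (regular_on_cst (u := delta_mx ord0 ord0)); last 2 first.
  + exact: delta_sphere.
  + by move=> z /connected_component_sub[_ /= pz]; apply: g_pole; rewrite pz.
  by apply: subset_trans S2V; exact: connected_component_sub.
- move=> x Vx; have [N [oN Nx] NC] := Ck_collapse k (p_neq0 x Vx).
  (* [g] is of class C^k on the ambient open set [N], so a chart with image in [N] pulls it back to
     a map of class C^k. *)
  have [d [U [phi [phiP phix oU UN phiC]]]] :=
    nonsingular_parametrization (V_nonsingular x Vx) Vx (open_nbhs_nbhs (conj oN Nx)).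
  exists d, U, phi; split=> //.
  apply: class_C_open_coord => // i.
  exact: (phiC k (fun y => g y ord0 i) N oN UN (NC i)).
Qed.
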